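(* Let $\mathfrak p=\mathbb{S}_{\mathcal N}\otimes\pi_{C\mathcal N}^{-1}(\mathfrak q)$ be a prime ideal of $\mathbb{S}_n$, where $\mathcal N\subseteq\{1,\dots,n\}$ and $\mathfrak q\in\mathrm{Spec}(L_{C\mathcal N})$ (every prime of $\mathbb{S}_n$ has a unique such form). Then: (1) $\mathrm{ht}(\mathfrak p)=|C\mathcal N|+\mathrm{ht}_{L_{C\mathcal N}}(\mathfrak q)$; (2) $\mathrm{cht}(\mathfrak p)=2|\mathcal N|+\mathrm{cht}_{L_{C\mathcal N}}(\mathfrak q)$; (3) $\mathrm{ht}(\mathfrak p)+\mathrm{cht}(\mathfrak p)=\mathrm{cl.Kdim}(\mathbb{S}_n)=2n$.
   Context: $K$ is a field. $\mathbb{S}_n$ is the $K$-algebra generated by $x_1,\dots,x_n,y_1,\dots,y_n$ subject to the defining relations $y_ix_i=1$ for all $i$, and $[x_i,y_j]=[x_i,x_j]=[y_i,y_j]=0$ for all $i\ne j$. For each $i$, $\mathbb{S}_1(i)$ is the subalgebra generated by $x_i,y_i$, and $\mathbb{S}_n=\mathbb{S}_1(1)\otimes\cdots\otimes\mathbb{S}_1(n)$. $F(i)=\bigoplus_{k,l\in\mathbb N}K(x_i^ky_i^l-x_i^{k+1}y_i^{l+1})$, an ideal of $\mathbb{S}_1(i)$ with $\mathbb{S}_1(i)/F(i)\cong K[x_i,x_i^{-1}]$. For $\mathcal N\subseteq\{1,\dots,n\}$, let $C\mathcal N$ be its complement and define: - $\mathbb{S}_{\mathcal N}=\bigotimes_{i\in\mathcal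 N}\mathbb{S}_1(i)$ ($=K$ if empty); - $L_{\mathcal N}=K[x_i,x_i^{-1}:i\in\mathcal N]$; - $\mathfrak a_{\mathcal N}=\sum_{i\in\mathcal N}\big(F(i)\otimes\bigotimes_{j\in\mathcal N\setminus\{i\}}\mathbb{S}_1(j)\big)$; - $\pi_{\mathcal N}:\mathbb{S}_{\mathcal N}\to\mathbb{S}_{\mathcal N}/\mathfrak a_{\mathcal N}\cong L_{\mathcal N}$. $\mathrm{ht}$ denotes height of a prime. The co-height is $\mathrm{cht}(\mathfrak p)=\mathrm{cl.Kdim}(A/\mathfrak p)$, the classical Krull dimension of the factor ring; subscripts indicate the ring in which height and co-height are computed. *)

(* Defs.v *)
From HB Require Import structures.
From mathcomp Require Import all_boot all_order all_algebra.
Set Implicit Arguments. Unset Strict Implicit. Unset Printing Implicit Defensive.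
Import GRing.Theory.
Local Open Scope ring_scope.

Section IdealTheory.
Variable R : pzRingType.

Definition is_ideal (I : R -> Prop) : Prop :=
  [/\ I 0, (forall a b, I a -> I b -> I (a + b)),
      (forall r a, I a -> I (r * a)) & (forall r a, I a -> I (a * r))].

Definition is_prime (P : R -> Prop) : Prop :=
  [/\ is_ideal P, ~ P 1 &
      forall I J : R -> Prop, is_ideal I -> is_ideal J ->
        (forall a b, I a -> J b -> P (a * b)) ->
        (forall a, I a -> P a) \/ (forall a, J a -> P a)].

Definition same_ideal (I J : R -> Prop) : Prop := forall a, I a <-> J a.

Definition strict_sub (I J : R -> Prop) : Prop :=
  (forall a, I a -> J a) /\ exists a, J a /\ ~ I a.

Definition prime_chain (c : nat -> R -> Prop) (m : nat) : Prop :=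
  (forall i, (i <= m)%N -> is_prime (c i)) /\
  (forall i, (i < m)%N -> strict_sub (c i) (c i.+1)).

Definition height_is (P : R -> Prop) (m : nat) : Prop :=
  (exists c, prime_chain c m /\ same_ideal (c m) P) /\
  (forall c k, prime_chain c k -> same_ideal (c k) P -> (k <= m)%N).

Definition kdim_is (m : nat) : Prop :=
  (exists c, prime_chain c m) /\ (forall c k, prime_chain c k -> (k <= m)%N).

(* cht(P) = cl.Kdim(R/P) = m, computed via the primes of R containing P
   (which correspond to the primes of R/P) *)
Definition coheight_is (P : R -> Prop) (m : nat) : Prop :=
  (exists c, prime_chain c m /\ same_ideal (c 0%N) P) /\
  (forall c k, prime_chain c k -> same_ideal (c 0%N) P -> (k <= m)%N).

End IdealTheory.

Definition is_alg_hom (K : pzRingType) (A B : algType K) (f : A -> B) : Prop :=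
  [/\ (forall a b, f (a + b) = f a + f b), (forall a b, f (a * b) = f a * f b),
      f 1 = 1 & (forall (k : K) a, f (k *: a) = k *: f a)].

Definition jacobson_rels (K : pzRingType) (n : nat) (B : algType K)
  (a b : 'I_n -> B) : Prop :=
  (forall i, b i * a i = 1) /\
  (forall i j, i != j ->
     [/\ a i * b j = b j * a i, a i * a j = a j * a i & b i * b j = b j * b i]).

Definition presents_Sn (K : pzRingType) (n : nat) (A : algType K)
  (x y : 'I_n -> A) : Prop :=
  jacobson_rels x y /\
  forall (B : algType K) (a b : 'I_n -> B), jacobson_rels a b ->
    (exists f : A -> B, is_alg_hom f /\ forall i, f (x i) = a i /\ f (y i) = b i) /\
    (forall f g : A -> B, is_alg_hom f -> is_alg_hom g ->
       (forall i, f (x i) = g (x i) /\ f (y i) = g (y i)) -> forall z, f z = g z).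

Definition presents_Laurent (K : pzRingType) (n : nat) (S : {set 'I_n})
  (L : comAlgType K) (t u : 'I_n -> L) : Prop :=
  (forall i, i \in S -> t i * u i = 1) /\
  forall (B : comAlgType K) (a b : 'I_n -> B),
    (forall i, i \in S -> a i * b i = 1) ->
    (exists f : L -> B, is_alg_hom f /\
        forall i, i \in S -> f (t i) = a i /\ f (u i) = b i) /\
    (forall f g : L -> B, is_alg_hom f -> is_alg_hom g ->
       (forall i, i \in S -> f (t i) = g (t i)) -> forall z, f z = g z).

Inductive subalg (K : pzRingType) (n : nat) (A : algType K) (x y : 'I_n -> A)
  (N : {set 'I_n}) : A -> Prop :=
| subalg_x i : i \in N -> subalg x y N (x i)
| subalg_y i : i \in N -> subalg x y N (y i)
| subalg_1 : subalg x y N 1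
| subalg_add a b : subalg x y N a -> subalg x y N b -> subalg x y N (a + b)
| subalg_mul a b : subalg x y N a -> subalg x y N b -> subalg x y N (a * b)
| subalg_scale (k : K) a : subalg x y N a -> subalg x y N (k *: a).

Definition is_pi (K : pzRingType) (n : nat) (A : algType K) (x y : 'I_n -> A)
  (S : {set 'I_n}) (L : comAlgType K) (t u : 'I_n -> L) (pi : A -> L) : Prop :=
  [/\ (forall a b, subalg x y S a -> subalg x y S b -> pi (a + b) = pi a + pi b),
      (forall a b, subalg x y S a -> subalg x y S b -> pi (a * b) = pi a * pi b),
      pi 1 = 1,
      (forall (k : K) a, subalg x y S a -> pi (k *: a) = k *: pi a) &
      (forall i, i \in S -> pi (x i) = t i /\ pi (y i) = u i)].

Definition pi_preimage (K : pzRingType) (n : nat) (A : algType K) (x y : 'I_n -> A)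
  (S : {set 'I_n}) (L : comAlgType K) (pi : A -> L) (q : L -> Prop) : A -> Prop :=
  fun a => subalg x y S a /\ q (pi a).

(* S_N ⊗ I, viewed inside S_n = S_N ⊗ S_{CN} via s ⊗ r |-> s r :
   the K-span of products s * r with s in S_N and r in I *)
Definition tensor_ideal (K : pzRingType) (n : nat) (A : algType K) (x y : 'I_n -> A)
  (N : {set 'I_n}) (I : A -> Prop) : A -> Prop :=
  fun a => exists s : seq (A * A),
    (forall z, z \in s -> subalg x y N z.1 /\ I z.2) /\
    a = \sum_(z <- s) z.1 * z.2.

(* Main.v *)
(* Let e_i = 1 - x_i y_i, an idempotent generating F(i).  A prime P of S_n is determined by the set
   J = {i | e_i in P} together with the prime Q = P /\ K[x_j : j in J] of a polynomial ring: for i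
   outside J one compresses to the corner e_i S_n e_i, on which the i-th tensor factor becomes K, and
   for j in J the x_j are central and invertible modulo P.  Conversely every such pair (J, Q) comes
   from a prime, the kernel of the representation of S_n by shifts (i outside J) and scalars
   (j in J) on functions N^n -> Frac(K[x] / Q); forgetting the boundary in a direction i turns the
   shift into a scalar, so that enlarging J enlarges the kernel.

   The rank 2 (n - |J|) + trdeg(K[x_J] / Q) is at most 2n and strictly decreases along inclusions of
   primes.  It therefore suffices to exhibit through the given prime a chain of length 2n, split by
   it into the two announced lengths; the heights and co-heights are then automatically exact.  The
   same scheme with the rank trdeg and bound d settles Laurent polynomials in d variables:
   downwards, replace the variables outside a transcendence basis by indeterminates one after the
   other; upwards, lower the transcendence degree by one as in [prime_above]. *)
Require Import Defs.
From HB Require Import structures.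
From mathcomp Require Import all_boot all_order all_algebra.
From mathcomp Require Import fraction generic_quotient ring_quotient.
From mathcomp Require Import boolp.
From mathcomp Require classical_sets.
From mathcomp Require Import ring zify.
From mathcomp.multinomials Require Import mpoly.
Set Implicit Arguments. Unset Strict Implicit. Unset Printing Implicit Defensive.
Import GRing.Theory.
Local Open Scope ring_scope.

(** * Primes of commutative rings as points of fields *)

(** The factor 2 in the rank: when the support grows by k indices, the first summand falls by 2k,
    while the new [x_j] return at most k through the transcendence degree. In a longest chain both
    units of an index show up as separate inclusions: first e_i enters with [x_i] transcendental,
    then [x_i] becomes algebraic. Two devices make different supports comparable. All contractions
    live in one polynomial ring in n variables, those outside J being set to 1; and all
    representations act on the same space of functions on N^n. The delicate step is upwards: a
    larger prime must lose only one degree of transcendence and still contain no variable. Adding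
    x_j - a with a in K can fail, since x_j - a may be invertible modulo Q, for example if Q
    contains (x_j - a) x_k - 1. Hence the choice 1 + x_j c, with c a common denominator of all
    variables and their inverses: it is prime to c, so integral equations over K[x_J][1/c] keep it
    from becoming a unit. The given prime is identified by its invariants: it is shown to lie in the
    prime constructed from the expected pair, which excludes further idempotents and polynomials. *)

Section DomainOfRing.
Variables (R : comNzRingType).

Definition integral_dom := forall a b : R, a * b = 0 -> (a == 0) || (b == 0).
(** A quotient by a prime ideal comes without an inverse function, which the fraction field
    construction asks for; this copy of [R] receives one by choice. *)
Definition dom_of_ring of integral_dom : Type := R.
Variable R_dom : integral_dom.
Local Notation D := (dom_of_ring R_dom).
HB.instance Definition _ := GRing.ComNzRing.on D.

Definition dom_unit : {pred D} := fun a => `[< exists b : D, b * a = 1 >].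
Definition dom_inv (a : D) : D :=
  if pselect (exists b : D, b * a = 1) is left e then projT1 (cid e) else a.

Fact dom_mulVx : {in dom_unit, left_inverse 1 dom_inv *%R}.
Proof. by move=> a /asboolP Ua; rewrite /dom_inv; case: pselect => // e; case: cid. Qed.

Fact dom_unitPl (a b : D) : b * a = 1 -> dom_unit a.
Proof. by move=> ba; apply/asboolP; exists b. Qed.

Fact dom_inv_out : {in [predC dom_unit], dom_inv =1 id}.
Proof. by move=> a; rewrite inE /dom_inv => /asboolPn; case: pselect. Qed.

HB.instance Definition _ :=
  GRing.ComNzRing_hasMulInverse.Build D dom_mulVx dom_unitPl dom_inv_out.
HB.instance Definition _ := GRing.ComUnitRing_isIntegral.Build D R_dom.
End DomainOfRing.

Lemma is_ideal_opp (R : pzRingType) (I : R -> Prop) a : is_ideal I -> I a -> I (- a).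
Proof. by case=> _ _ IM _ Ia; rewrite -mulN1r; apply: IM. Qed.

Section PrimePoint.
Variables (R : comNzRingType) (Q : R -> Prop).

Definition comm_prime := [/\ is_ideal Q, ~ Q 1 & forall a b, Q (a * b) -> Q a \/ Q b].

Lemma is_prime_comm : is_prime Q -> comm_prime.
Proof.
case=> Qi Q1 Qp; split=> // a b Qab.
pose gen (c : R) := fun r => exists s, r = s * c.
have genI c : is_ideal (gen c).
  split; first by exists 0; rewrite mul0r.
  - by move=> _ _ [s ->] [t ->]; exists (s + t); rewrite mulrDl.
  - by move=> r _ [s ->]; exists (r * s); rewrite mulrA.
  - by move=> r _ [s ->]; exists (r * s); rewrite mulrC mulrA.
case: (Qp (gen a) (gen b) (genI _) (genI _)) => [|H|H].
- move=> _ _ [s ->] [t ->]; rewrite mulrACA.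
  by case: Qi => _ _ QM _; apply: QM.
- by left; apply: H; exists 1; rewrite mul1r.
- by right; apply: H; exists 1; rewrite mul1r.
Qed.

Lemma comm_is_prime : comm_prime -> is_prime Q.
Proof.
case=> Qi Q1 Qp; split=> // I J Ii Ji IJ.
case: (pselect (exists2 a, I a & ~ Q a)) => [[a Ia nQa]|nI].
  by right=> b Jb; case: (Qp a b (IJ _ _ Ia Jb)).
by left=> a Ia; apply: contrapT => nQa; apply: nI; exists a.
Qed.

Hypothesis Qprime : comm_prime.

Definition prime_pred : {pred R} := fun a => `[< Q a >].

Fact prime_pred_closed : idealr_closed prime_pred.
Proof.
case: Qprime => -[Q0 QD QM _] Q1 _; split; first exact/asboolP.
  by apply/negP => /asboolP.
by move=> a u v /asboolP Qu /asboolP Qv; apply/asboolP/QD => //; apply: QM.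
Qed.

Fact prime_pred_prime : prime_idealr_closed prime_pred.
Proof.
case: Qprime => _ _ Qp u v /asboolP /Qp[?|?]; apply/orP; [left|right]; exact/asboolP.
Qed.

HB.instance Definition _ := isIdealr.Build R prime_pred prime_pred_closed.
HB.instance Definition _ := isPrimeIdealrClosed.Build R prime_pred prime_pred_prime.

Lemma prime_point : exists (F : fieldType) (f : {rmorphism R -> F}),
  forall a, Q a <-> f a = 0.
Proof.
pose I : prime_idealr R := prime_pred.
pose D : idomainType := dom_of_ring (@Quotient.rquot_IdomainAxiom R I).
pose g : {rmorphism R -> D} := (\pi_({ideal_quot I})%qT : R -> D).
exists {fraction D}, (@tofrac D \o g) => a /=.
split=> [Qa|/eqP].
  apply/eqP; rewrite tofrac_eq0; apply/eqP.
  rewrite -[RHS](rmorph0 g); apply/eqP; rewrite -Quotient.idealrBE subr0.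
  exact/asboolP.
rewrite tofrac_eq0 => /eqP; rewrite -[RHS](rmorph0 g) => /eqP.
by rewrite -Quotient.idealrBE subr0 => /asboolP.
Qed.
End PrimePoint.

Lemma ker_comm_prime (R : comNzRingType) (D : idomainType) (f : {rmorphism R -> D})
  (Q : R -> Prop) : (forall a, Q a <-> f a = 0) -> comm_prime Q.
Proof.
move=> E; split; first split.
- by apply/E; rewrite rmorph0.
- by move=> a b /E a0 /E b0; apply/E; rewrite rmorphD a0 b0 addr0.
- by move=> a b /E b0; apply/E; rewrite rmorphM b0 mulr0.
- by move=> a b /E b0; apply/E; rewrite rmorphM b0 mul0r.
- by move/E/eqP; rewrite rmorph1 oner_eq0.
- by move=> a b /E/eqP; rewrite rmorphM mulf_eq0 => /orP[]/eqP ?; [left|right]; apply/E.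
Qed.

(** * Algebraic dependence of variables modulo a prime *)

Lemma mpoly_gen_ind (n : nat) (R : nzRingType) (P : {mpoly R[n]} -> Prop) :
  (forall c, P c%:MP) -> (forall i, P 'X_i) ->
  (forall p q, P p -> P q -> P (p + q)) -> (forall p q, P p -> P q -> P (p * q)) ->
  forall p, P p.
Proof.
move=> PC PX PD PM p.
have P0 : P 0 by rewrite -mpolyC0.
have P1 : P 1 by rewrite -mpolyC1.
rewrite (mpolyE p); apply: (big_ind P) => // m _.
rewrite -mul_mpolyC; apply: (PM) => //; rewrite (mpolyXE_id _ m).
apply: (big_ind P) => // i _; elim: (m i) => [|k IH]; first by rewrite expr0.
by rewrite exprS; apply: PM.
Qed.

Lemma mpoly_morph_ext (n : nat) (R S : nzRingType) (f g : {rmorphism {mpoly R[n]} -> S}) :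
  (forall c, f c%:MP = g c%:MP) -> (forall i, f 'X_i = g 'X_i) -> f =1 g.
Proof.
move=> fgC fgX; elim/mpoly_gen_ind => // p q fgp fgq.
  by rewrite !rmorphD /= fgp fgq.
by rewrite !rmorphM /= fgp fgq.
Qed.

Section Substitutions.
Variables (K : fieldType) (n : nat).
Local Notation R := {mpoly K[n]}.
Implicit Types (J : {set 'I_n}) (p : R).

(* The retraction of [K[x_1, .., x_n]] onto its subring [K[x_j : j in J]]. *)
Definition proj_vars J : R -> R :=
  mmap (@mpolyC n K) (fun i => if i \in J then 'X_i else 0).
HB.instance Definition _ J := GRing.RMorphism.on (proj_vars J).

(* [p] seen as a polynomial in [x_i]; its coefficients do not involve [x_i]. *)
Definition split_var (i : 'I_n) : R -> {poly R} :=
  mmap (polyC \o @mpolyC n K) (fun k => if k == i then 'X else ('X_k)%:P).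
HB.instance Definition _ i := GRing.RMorphism.on (split_var i).

Lemma proj_varsC J c : proj_vars J c%:MP = c%:MP.
Proof. exact: mmapC. Qed.

Lemma proj_varsX J i : proj_vars J 'X_i = if i \in J then 'X_i else 0.
Proof. by rewrite /proj_vars mmapX mmap1U. Qed.

Lemma proj_vars_sub J J' p : J \subset J' -> proj_vars J' (proj_vars J p) = proj_vars J p.
Proof.
move=> /subsetP sJ; apply: (mpoly_morph_ext (f := proj_vars J' \o proj_vars J)).
  by move=> c; rewrite /= !proj_varsC.
move=> i; rewrite /= !proj_varsX; case: ifP => [/sJ iJ'|_]; last exact: rmorph0.
by rewrite proj_varsX iJ'.
Qed.

Lemma split_varC i c : split_var i c%:MP = c%:MP%:P.
Proof. exact: mmapC. Qed.

Lemma split_varX i k : split_var i 'X_k = if k == i then 'X else ('X_k)%:P.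
Proof. by rewrite /split_var mmapX mmap1U. Qed.

Lemma split_varK i p : (split_var i p).['X_i] = p.
Proof.
apply: (mpoly_morph_ext (f := horner_eval 'X_i \o split_var i) (g := idfun)) => [c|k] /=.
  by rewrite split_varC /horner_eval hornerC.
by rewrite split_varX /horner_eval; case: eqP => [->|_]; rewrite ?hornerX ?hornerC.
Qed.

Lemma split_var_proj i J p : i \notin J ->
  split_var i (proj_vars (i |: J) p) = map_poly (proj_vars J) (split_var i p).
Proof.
move=> iJ; apply: (mpoly_morph_ext (f := split_var i \o proj_vars (i |: J))
  (g := map_poly (proj_vars J) \o split_var i)) => [c|k] /=.
  by rewrite proj_varsC split_varC map_polyC /= proj_varsC.
rewrite proj_varsX split_varX !inE; case: (eqVneq k i) => [->|ki] /=.
  by rewrite map_polyX split_varX eqxx.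
rewrite map_polyC /= proj_varsX; case: ifP => _; last by rewrite !rmorph0.
by rewrite split_varX (negbTE ki).
Qed.

Lemma split_var_const i J p : i \notin J ->
  split_var i (proj_vars J p) = (proj_vars J p)%:P.
Proof.
move=> iJ; apply: (mpoly_morph_ext (f := split_var i \o proj_vars J)
  (g := polyC \o proj_vars J)) => [c|k] /=.
  by rewrite proj_varsC split_varC.
rewrite proj_varsX; case: ifP => kJ; last by rewrite !rmorph0.
by rewrite split_varX; case: eqP => // ki; rewrite -ki kJ in iJ.
Qed.

End Substitutions.

Section AlgebraicDependence.
Variables (K : fieldType) (n : nat).
Local Notation R := {mpoly K[n]}.
Implicit Types (J : {set 'I_n}) (Q : R -> Prop).

(* [Q] meets [K[x_j : j in J]] trivially, i.e. these variables are algebraically independent mod [Q]. *)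
Definition indep Q J := forall p, Q (proj_vars J p) -> proj_vars J p = 0.

Definition max_indep Q J := indep Q J /\ forall i, i \notin J -> ~ indep Q (i |: J).

(* The variables generate, so for prime [Q] this is the transcendence degree of [K[x] / Q]. *)
Definition trdeg Q : nat := \max_(J : {set 'I_n} | `[< indep Q J >]) #|J|.

Lemma indep_mono Q Q' J : (forall p, Q p -> Q' p) -> indep Q' J -> indep Q J.
Proof. by move=> QQ' iJ p /QQ'/iJ. Qed.

Lemma indep_trdeg Q J : indep Q J -> (#|J| <= trdeg Q)%N.
Proof. by move=> iJ; apply: (leq_bigmax_cond (F := fun J : {set _} => #|J|)); apply/asboolP. Qed.

Lemma proj_vars0 (p : R) : proj_vars set0 p = (p@_0%MM)%:MP.
Proof.
apply: (mpoly_morph_ext (f := proj_vars set0)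
  (g := @mpolyC n K \o mcoeff 0%MM)) => [c|k] /=.
  by rewrite proj_varsC mcoeffC eqxx mulr1.
by rewrite proj_varsX finset.in_set0 mcoeffX mnm1_eq0 mpolyC0.
Qed.

Lemma indep0 Q : is_ideal Q -> ~ Q 1 -> indep Q set0.
Proof.
move=> [_ _ QM _] Q1 p; rewrite proj_vars0 => Qc.
have [->|c0] := eqVneq (p@_0%MM) 0; first exact: mpolyC0.
case: Q1; have := QM (p@_0%MM)^-1%:MP _ Qc.
by rewrite -mpolyCM mulVf // mpolyC1.
Qed.

Lemma trdegP Q : is_ideal Q -> ~ Q 1 -> exists2 J, indep Q J & #|J| = trdeg Q.
Proof.
move=> Qi /(indep0 Qi) i0; have /asboolP A0 := i0.
have [|J /asboolP iJ Jmax] := @eq_bigmax_cond _ [pred J : {set 'I_n} | `[< indep Q J >]] (fun J => #|J|).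
  by apply/card_gt0P; exists set0.
by exists J => //; rewrite /trdeg -Jmax.
Qed.

Lemma indep_extend Q J : indep Q J -> exists2 J' : {set 'I_n}, J \subset J' & max_indep Q J'.
Proof.
move=> /asboolP iJ.
have [J' /maxsetP[/asboolP iJ' mJ] sJ] :=
  maxset_exists (P := fun J : {set 'I_n} => `[< indep Q J >]) iJ.
exists J' => //; split=> // i iNJ ii; move: (iNJ).
by rewrite -(mJ (i |: J')) ?setU11 ?subsetUr //; apply/asboolP.
Qed.

Lemma trdeg_max_indep Q J : indep Q J -> (trdeg Q <= #|J|)%N -> max_indep Q J.
Proof.
move=> iJ le; split=> // i iNJ /indep_trdeg; rewrite cardsU1 iNJ /= => lt.
by have := leq_trans lt le; rewrite ltnn.
Qed.

End AlgebraicDependence.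

(** * Clearing denominators over a transcendence basis *)

Section Denominators.
Variables (D : comNzRingType) (F : fieldType) (psi : {rmorphism D -> F}).
Implicit Types (w : F) (P : {poly D}).

(* Algebraicity over the field of fractions of the image of [psi]. *)
Definition frac_alg w := exists2 P, map_poly psi P != 0 & root (map_poly psi P) w.

Definition frac_integral w := exists2 c, psi c != 0 & integralOver psi (psi c * w).

Lemma frac_alg_integral w : frac_alg w -> frac_integral w.
Proof.
case=> P nzP rP; set p := map_poly psi P in nzP rP.
have sp : (1 < size p)%N by exact: root_size_gt1 nzP rP.
set d := (size p).-1; have dE : size p = d.+1 by rewrite /d prednK // (ltn_trans _ sp).
have d0 : (0 < d)%N by move: sp; rewrite dE.
set c := P`_d; have pc : psi c = lead_coef p by rewrite lead_coefE dE /= coef_map.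
have c0 : psi c != 0 by rewrite pc lead_coef_eq0.
exists c => //.
(* Multiplying the equation of degree [d] for [w] by the power [d.-1] of its leading coefficient
   turns it into the monic equation ['X^d + T] for [c * w]. *)
pose T := \poly_(k < d) (P`_k * c ^+ (d.-1 - k)).
have sT : (size T <= d)%N by apply: size_poly.
exists ('X^d + T); first by rewrite monicE lead_coefDl ?size_polyXn ?ltnS // lead_coefXn.
rewrite rmorphD /= map_polyXn rootE hornerD hornerXn.
have := eqP rP; rewrite horner_coef dE big_ord_recr /= => r0.
rewrite -(mulr0 (psi c ^+ d.-1)) -r0 mulrDr addrC; apply/eqP; congr (_ + _).
  rewrite /T poly_def rmorph_sum horner_sum mulr_sumr /=.
  apply: eq_bigr => k _; rewrite -mul_polyC rmorphM /= map_polyC map_polyXn /=.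
  rewrite hornerM hornerC hornerXn rmorphM rmorphXn exprMn coef_map /=.
  have kd : (k <= d.-1)%N by rewrite -ltnS prednK.
  have -> : psi c ^+ d.-1 = psi c ^+ (d.-1 - k) * psi c ^+ k by rewrite -exprD subnK.
  by rewrite [psi P`_k * _]mulrC mulrACA.
by rewrite coef_map -/c exprMn mulrA -exprSr prednK.
Qed.

(** Since [h] is nonzero, factors ['X] can be cancelled from the equation until its constant term
    survives. This yields inverses of algebraic elements, and nonzero elements of K[x_J] in an ideal
    containing [h]. *)
Lemma root_const_term h P : h != 0 -> map_poly psi P != 0 -> root (map_poly psi P) h ->
  exists P' c, psi c != 0 /\ (map_poly psi P').[h] * h = - psi c.
Proof.
move=> h0; elim/poly_ind: P => [|P c IH]; first by rewrite rmorph0 eqxx.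
rewrite rmorphD rmorphM /= map_polyX map_polyC /= => nz.
rewrite rootE hornerMXaddC => r; have [c0|c0] := eqVneq (psi c) 0.
  apply: IH; move: nz r; rewrite c0 polyC0 addr0.
    by move=> nz _; apply: contraNneq nz => ->; rewrite mul0r.
  by move=> _; rewrite addr0 mulf_eq0 (negbTE h0) orbF.
by exists P, c; split=> //; apply/eqP; rewrite -addr_eq0.
Qed.

Lemma frac_integral_common (ws : seq F) : {in ws, forall w, frac_integral w} ->
  exists2 c, psi c != 0 & {in ws, forall w, integralOver psi (psi c * w)}.
Proof.
elim: ws => [_|w ws IH aw]; first by exists 1; rewrite ?rmorph1 ?oner_eq0.
have [w' w'ws|c c0 ic] := IH; first by apply: aw; rewrite inE w'ws orbT.
have [c' c'0 ic'] := aw w (mem_head _ _).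
exists (c * c'); first by rewrite rmorphM mulf_neq0.
move=> v; rewrite inE rmorphM => /orP[/eqP->|/ic iv].
  by rewrite -mulrA; apply: integral_mul => //; apply: integral_id.
by rewrite [psi c * _]mulrC -mulrA; apply: integral_mul => //; apply: integral_id.
Qed.

End Denominators.

Section BoundedDenominators.
Variables (D : comNzRingType) (F : fieldType) (psi : {rmorphism D -> F}) (c : D).

(** For [psi c] nonzero this is integrality over the image of [psi] localised at [psi c]. Leaving
    the exponent free makes these elements a ring. *)
Definition denom_bounded v := exists r, integralOver psi (psi c ^+ r * v).

Lemma denom_bounded_integral v : integralOver psi v -> denom_bounded v.
Proof. by exists 0; rewrite expr0 mul1r. Qed.

Lemma denom_boundedM v w : denom_bounded v -> denom_bounded w -> denom_bounded (v * w).
Proof. by move=> [r iv] [s iw]; exists (r + s)%N; rewrite exprD mulrACA; apply: integral_mul. Qed.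

Lemma integralXn v r : integralOver psi v -> integralOver psi (v ^+ r).
Proof.
move=> iv; elim: r => [|r IH]; first by rewrite expr0; apply: integral1.
by rewrite exprS; apply: integral_mul.
Qed.

Lemma denom_boundedD v w : denom_bounded v -> denom_bounded w -> denom_bounded (v + w).
Proof.
have ic k : integralOver psi (psi c ^+ k) by apply/integralXn/integral_id.
move=> [r iv] [s iw]; exists (r + s)%N; rewrite mulrDr; apply: integral_add.
  by rewrite exprD mulrAC mulrC; apply: integral_mul.
by rewrite exprD -mulrA; apply: integral_mul.
Qed.

Lemma denom_boundedXn v r : denom_bounded v -> denom_bounded (v ^+ r).
Proof.
move=> bv; elim: r => [|r IH]; first by rewrite expr0; apply/denom_bounded_integral/integral1.
by rewrite exprS; apply: denom_boundedM.
Qed.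

Lemma denom_bounded_horner v (P : {poly D}) :
  denom_bounded v -> denom_bounded (map_poly psi P).[v].
Proof.
move=> bv; elim/poly_ind: P => [|P a IH].
  by rewrite rmorph0 horner0; apply/denom_bounded_integral/integral0.
rewrite rmorphD rmorphM /= map_polyX map_polyC hornerMXaddC.
by apply: denom_boundedD; [apply: denom_boundedM | apply/denom_bounded_integral/integral_id].
Qed.
End BoundedDenominators.

(** An equation with nonzero constant term [a] writes the inverse of [w] as a polynomial in [w]
    divided by [- psi a], and polynomials in [w] have bounded denominators. *)
Lemma frac_integralV (D : comNzRingType) (F : fieldType) (psi : {rmorphism D -> F}) w :
  frac_alg psi w -> frac_integral psi w^-1.
Proof.
have [->|nz] := eqVneq w 0.
  by rewrite invr0; exists 1; rewrite ?mulr0 ?rmorph1 ?oner_eq0 //; apply: integral0.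
move=> aw; have [c c0 ic] := frac_alg_integral aw.
have [P nzP rP] := aw; have [P' [a [a0 Pa]]] := root_const_term nz nzP rP.
have bw : denom_bounded psi c w by exists 1; rewrite expr1.
have [r ir] := denom_bounded_horner P' bw.
exists (a * c ^+ r); first by rewrite rmorphM rmorphXn mulf_neq0 // expf_neq0.
have -> : psi (a * c ^+ r) / w = - (psi c ^+ r * (map_poly psi P').[w]).
  have -> : (map_poly psi P').[w] = - psi a / w by rewrite -Pa mulfK.
  by rewrite rmorphM rmorphXn mulNr mulrN opprK mulrA [psi a * _]mulrC.
exact: integral_opp.
Qed.

Section TranscendenceSteps.
Variables (K : fieldType) (n : nat).
Local Notation R := {mpoly K[n]}.
Implicit Types (J : {set 'I_n}) (Q : R -> Prop).

Section Point.
Variables (F : fieldType) (phi : {rmorphism R -> F}) (Q : R -> Prop).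
Hypothesis Qphi : forall p, Q p <-> phi p = 0.
Variable J : {set 'I_n}.
Hypothesis Jmax : max_indep Q J.
Local Notation psi := (phi \o proj_vars J).

(** For [i] outside [J], a relation among the variables [i |: J], read as a polynomial in [x_i], has
    coefficients in K[x_J]; they cannot all vanish modulo [Q], because [J] is independent. *)
Lemma max_indep_alg i : frac_alg psi (phi 'X_i).
Proof.
have [iJ|iNJ] := boolP (i \in J).
  exists ('X - ('X_i)%:P); rewrite rmorphB /= map_polyX map_polyC /= proj_varsX iJ.
    by rewrite polyXsubC_eq0.
  by rewrite root_XsubC.
case: Jmax => iJ /(_ i iNJ) /existsNP[p /not_implyP[Qp nz]].
set P := map_poly (proj_vars J) (split_var i p).
have PE : P.['X_i] = proj_vars (i |: J) p by rewrite /P -split_var_proj ?split_varK.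
have mE : map_poly psi (split_var i p) = map_poly phi P by rewrite map_poly_comp.
exists (split_var i p); rewrite mE.
  apply/eqP => mP0; apply: nz; rewrite -PE [P](_ : _ = 0) ?horner0 //.
  apply/polyP => k; rewrite coef0 /P coef_map /=; apply: iJ; apply/Qphi.
  by have /polyP/(_ k) := mP0; rewrite coef0 !coef_map.
by rewrite rootE horner_map PE; apply/eqP/Qphi.
Qed.

(** One [c] serves all variables and their inverses, hence every polynomial divided by a monomial.
    The quotients by monomials are what [prime_above] needs to stay away from the variables. *)
Lemma max_indep_denominator : exists2 c, psi c != 0 &
  forall p, denom_bounded psi c (phi p) /\
    forall m : 'X_{1..n}, denom_bounded psi c (phi p / phi 'X_[m]).
Proof.
pose ws := [seq phi 'X_i | i : 'I_n] ++ [seq (phi 'X_i)^-1 | i : 'I_n].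
have aw : {in ws, forall w, frac_integral psi w}.
  move=> w; rewrite mem_cat => /orP[] /imageP[i _ ->].
    exact/frac_alg_integral/max_indep_alg.
  exact/frac_integralV/max_indep_alg.
have [c c0 iws] := frac_integral_common aw; exists c => //.
have bX i : denom_bounded psi c (phi 'X_i).
  by exists 1; rewrite expr1; apply: iws; rewrite mem_cat image_f.
have bV i : denom_bounded psi c (phi 'X_i)^-1.
  by exists 1; rewrite expr1; apply: iws; rewrite mem_cat orbC image_f.
have b1 : denom_bounded psi c 1 by apply/denom_bounded_integral/integral1.
have bp p : denom_bounded psi c (phi p).
  elim/mpoly_gen_ind: p => [a|i|a b|a b]; rewrite ?rmorphD ?rmorphM //.
  - by rewrite -(proj_varsC J); apply/denom_bounded_integral/(integral_id psi).
  - exact: denom_boundedD.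
  - exact: denom_boundedM.
move=> p; split=> // m; apply: denom_boundedM => //.
rewrite (mpolyXE_id _ m) rmorph_prod -prodfV.
apply: big_ind => // [|i _]; first exact: denom_boundedM.
by rewrite rmorphXn -exprVn; apply: denom_boundedXn.
Qed.
End Point.

(* If [f] were nonzero mod [Q], then a multiple of [f] would be integral over [K[x_j : j in J]] and the
   constant term of its integral equation would be a nonzero element of [Q'] there. *)
Lemma max_indep_meets Q Q' J f : comm_prime Q -> is_ideal Q' -> ~ Q' 1 ->
  (forall p, Q p -> Q' p) -> max_indep Q J -> indep Q' J -> Q' f -> Q f.
Proof.
move=> Qp Q'i Q'1 QQ' Jmax iJ' Q'f.
have [F [phi Qphi]] := prime_point Qp.
have [c c0 /(_ f)[[r ih] _]] := max_indep_denominator Qphi Jmax.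
apply/Qphi; apply: contrapT => /eqP f0.
set H := proj_vars J c ^+ r * f.
have HE : phi H = (phi \o proj_vars J) c ^+ r * phi f by rewrite rmorphM rmorphXn.
move: ih; rewrite -HE => -[P monP rP].
have H0 : phi H != 0 by rewrite HE mulf_neq0 // expf_neq0.
have nzP : map_poly (phi \o proj_vars J) P != 0 by rewrite monic_neq0 ?monic_map.
have [P' [a [a0 Pa]]] := root_const_term H0 nzP rP.
case/eqP: a0; rewrite /= iJ' ?rmorph0 //.
pose G := (map_poly (proj_vars J) P').[H].
have Q'GH : Q' (G * H) by case: Q'i => _ _ QM _; apply/QM/QM.
have : Q (proj_vars J a + G * H).
  by apply/Qphi; rewrite rmorphD rmorphM -horner_map -map_poly_comp Pa /= addrN.
move/QQ' => Q's; rewrite -[proj_vars J a](addrK (G * H)).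
by case: (Q'i) => _ QD _ _; apply: QD => //; apply: is_ideal_opp.
Qed.

(** If the degree did not drop, a largest independent set for [Q'] would be maximal independent for
    [Q] as well, and [max_indep_meets] would give the inclusion of [Q'] in [Q]. *)
Lemma trdeg_lt Q Q' f : comm_prime Q -> is_ideal Q' -> ~ Q' 1 ->
  (forall p, Q p -> Q' p) -> Q' f -> ~ Q f -> (trdeg Q' < trdeg Q)%N.
Proof.
move=> Qp Q'i Q'1 QQ' Q'f Qf; rewrite ltnNge; apply/negP => le.
have [J iJ Jd] := trdegP Q'i Q'1; apply: Qf.
apply: (max_indep_meets (J := J)) Q'f => //.
by apply: trdeg_max_indep; rewrite ?Jd //; apply: indep_mono iJ.
Qed.

(* The prime of the point obtained from that of [Q] by making the [i]-th coordinate an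
   indeterminate, see [poly_extE]. *)
Definition poly_ext i Q : R -> Prop := fun p => forall k, Q (split_var i p)`_k.

Lemma poly_extE i Q (F : fieldType) (phi : {rmorphism R -> F}) :
  (forall p, Q p <-> phi p = 0) ->
  forall p, poly_ext i Q p <-> map_poly phi (split_var i p) = 0.
Proof.
move=> Qphi p; split=> [Ep|/polyP Ep k].
  by apply/polyP => k; rewrite coef_map coef0; apply/Qphi.
by apply/Qphi; have := Ep k; rewrite coef_map coef0.
Qed.

Lemma poly_ext_prime i Q : comm_prime Q -> comm_prime (poly_ext i Q).
Proof.
move=> Qp; have [F [phi Qphi]] := prime_point Qp.
exact: (ker_comm_prime (f := map_poly phi \o split_var i)) (poly_extE i Qphi).
Qed.

Lemma poly_ext_sub i Q p : is_ideal Q -> poly_ext i Q p -> Q p.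
Proof.
move=> [Q0 QD _ QM] Ep; rewrite -[p](split_varK i) horner_coef.
by apply: big_ind => // k _; apply: QM.
Qed.

Lemma poly_ext_const i Q J p : i \notin J -> is_ideal Q ->
  poly_ext i Q (proj_vars J p) <-> Q (proj_vars J p).
Proof.
move=> iJ Qi; split; first exact: poly_ext_sub.
move=> Qp k; rewrite split_var_const // coefC.
by case: eqP => // _; case: Qi.
Qed.

Lemma poly_ext_var_other i Q k c : k != i -> is_ideal Q ->
  poly_ext i Q ('X_k - c%:MP) <-> Q ('X_k - c%:MP).
Proof.
move=> ki Qi.
have <- : proj_vars [set k] ('X_k - c%:MP) = 'X_k - c%:MP.
  by rewrite rmorphB /= proj_varsX proj_varsC set11.
by apply: poly_ext_const => //; rewrite inE eq_sym.
Qed.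

Lemma poly_ext_var i Q c : is_ideal Q -> ~ Q 1 -> ~ poly_ext i Q ('X_i - c%:MP).
Proof.
move=> Qi Q1 /(_ 1%N); rewrite rmorphB /= split_varX split_varC eqxx.
by rewrite coefB coefX coefC subr0.
Qed.

(** Independence is checked on the coefficients in [x_i], which are elements of K[x_J] in [Q].
    Maximality is inherited because polynomials free of [x_i] belong to [poly_ext i Q] exactly when
    they belong to [Q]. *)
Lemma poly_ext_max_indep i Q J : comm_prime Q -> i \notin J -> max_indep Q J ->
  max_indep (poly_ext i Q) (i |: J).
Proof.
move=> Qp iNJ [iJ Jmax]; have [Qi Q1 _] := Qp; split.
  move=> p Ep; rewrite -[LHS](split_varK i) split_var_proj //.
  rewrite [map_poly _ _](_ : _ = 0) ?horner0 //; apply/polyP => k; rewrite coef0 coef_map /=.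
  by apply: iJ; have := Ep k; rewrite split_var_proj // coef_map.
move=> k; rewrite !inE negb_or => /andP[ki kJ] ind; apply: (Jmax k kJ) => p Qp'.
have sub : k |: J \subset k |: (i |: J) by rewrite setUS ?subsetUr.
rewrite -(proj_vars_sub p sub); apply: ind; rewrite (proj_vars_sub p sub).
by apply/poly_ext_const; rewrite // !inE negb_or eq_sym ki.
Qed.
End TranscendenceSteps.

(** * Prime avoidance and lowering the transcendence degree by one *)

Section PrimeAvoidance.
Variables (R : comNzRingType) (I S : R -> Prop).
Hypotheses (Iid : is_ideal I) (S1 : S 1) (SM : forall a b, S a -> S b -> S (a * b)).
Hypothesis IS : forall a, I a -> ~ S a.

Let good (A : R -> Prop) := [/\ is_ideal A, forall a, I a -> A a & forall a, A a -> ~ S a].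

Let good_add A a : good A -> exists2 B, is_ideal B &
  (forall b, A b -> B b) /\ B a /\ forall b, B b -> exists q r, A q /\ b = q + r * a.
Proof.
case=> -[A0 AD AM AM'] _ _; exists (fun b => exists q r, A q /\ b = q + r * a).
  split; first by exists 0, 0; rewrite mul0r addr0.
  - move=> _ _ [q [r [Aq ->]]] [q' [r' [Aq' ->]]]; exists (q + q'), (r + r').
    by rewrite mulrDl addrACA; split=> //; apply: AD.
  - move=> s _ [q [r [Aq ->]]]; exists (s * q), (s * r).
    by rewrite mulrDr mulrA; split=> //; apply: AM.
  - move=> s _ [q [r [Aq ->]]]; exists (s * q), (s * r).
    by rewrite [_ * s]mulrC mulrDr mulrA; split=> //; apply: AM.
split=> [b Ab|]; first by exists b, 0; rewrite mul0r addr0.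
by split=> //; exists 0, 1; rewrite add0r mul1r.
Qed.

Lemma prime_avoiding : exists Q, [/\ comm_prime Q, forall a, I a -> Q a &
  forall a, Q a -> ~ S a].
Proof.
pose P (A : classical_sets.set R) := (forall a, ~ A a) \/ good A.
have [F FP Ftot|A [PA Amax]] := @classical_sets.Zorn_bigcup R P.
  have [[A FA [a Aa]]|F0] := pselect (exists2 A, F A & exists a, A a); last first.
    by left=> a [A FA Aa]; apply: F0; exists A => //; exists a.
  have gd B b : F B -> B b -> good B by move=> FB Bb; case: (FP B FB) => // /(_ b).
  have [[A0 AD AM AM'] IA AS] := gd A a FA Aa.
  right; split; last by move=> b [B FB Bb]; case: (gd B b FB Bb) => _ _; apply.
    split; first by exists A.
    - move=> b c [B FB Bb] [C FC Cc].
      have [BC|CB] := Ftot B C FB FC.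
        by exists C => //; case: (gd C c FC Cc) => -[_ CD _ _] _ _; apply: CD => //; apply: BC.
      by exists B => //; case: (gd B b FB Bb) => -[_ BD _ _] _ _; apply: BD => //; apply: CB.
    - by move=> r b [B FB Bb]; exists B => //; case: (gd B b FB Bb) => -[_ _ BM _] _ _; apply: BM.
    - by move=> r b [B FB Bb]; exists B => //; case: (gd B b FB Bb) => -[_ _ _ BM] _ _; apply: BM.
  by move=> b Ib; exists A => //; apply: IA.
have gI : good I by split.
have gA : good A.
  case: PA => // A0; have I0 : I 0 by case: Iid.
  case: (Amax I); last by right.
  by split=> [a /A0//|sub]; apply: (A0 0); apply: sub.
exists A; have [Aid IA AS] := gA; split=> //; split=> //.
  by move/AS; apply.
move=> a b Aab; apply: contrapT => /not_orP[nAa nAb].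
have meets c : ~ A c -> exists q r, A q /\ S (q + r * c).
  move=> nAc; have [B Bid [AB [Bc BE]]] := good_add c gA.
  apply: contrapT => nS; apply: (Amax B).
    by split=> // sub; apply: nAc; apply: sub.
  right; split=> // [d /IA/AB//|d Bd Sd]; apply: nS.
  by have [q [r [Aq dE]]] := BE d Bd; exists q, r; rewrite -dE.
have [q [r [Aq Sq]]] := meets a nAa; have [q' [r' [Aq' Sq']]] := meets b nAb.
apply: (AS _ _ (SM Sq Sq')); case: (Aid) => _ AD AM AM'.
rewrite mulrDl !mulrDr mulrACA.
by apply: (AD); apply: (AD); first [exact: AM' | exact: AM].
Qed.
End PrimeAvoidance.

Section GoingUp.
Variables (K : fieldType) (n : nat).
Local Notation R := {mpoly K[n]}.
Implicit Types (J : {set 'I_n}) (Q : R -> Prop).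

Lemma split_var_inj i : injective (@split_var K n i).
Proof. by move=> p q pq; rewrite -[p](split_varK i) pq split_varK. Qed.

(** Modulo [f = 1 + 'X_j * c] one has ['X_j * c = -1], so multiplying by ['X_j ^+ r] removes the
    power of [c] and [f] would divide [proj_vars J s]. But [f] has positive degree in [x_j], even if
    [c] involves [x_j], whereas the other side has degree 0. *)
Lemma not_dvd_var_free j J (c s b : R) r : j \notin J -> c != 0 ->
  proj_vars J s != 0 -> proj_vars J s * c ^+ r <> (1 + 'X_j * c) * b.
Proof.
move=> jJ c0 s0 E; set f := 1 + 'X_j * c in E.
have [b' sE] : exists b', proj_vars J s = f * b'.
  have [g gE] : exists g, ('X_j * c) ^+ r = (-1) ^+ r + f * g.
    have -> : 'X_j * c = -1 + f by rewrite /f addrA addNr add0r.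
    elim: r {E} => [|r [g gE]]; first by exists 0; rewrite mulr0 addr0.
    exists (g * (-1 + f) + (-1) ^+ r); rewrite !exprSr gE.
    by move: ((-1) ^+ r) => e; ring.
  exists ((-1) ^+ r * ('X_j ^+ r * b - proj_vars J s * g)).
  have sq : (-1) ^+ r * (-1) ^+ r = 1 :> R by rewrite -exprMn mulrNN mulr1 expr1n.
  have E2 : proj_vars J s * ((-1) ^+ r + f * g) = f * ('X_j ^+ r * b).
    by rewrite -gE exprMn mulrCA E mulrCA.
  clearbody f; move: E2 sq.
  move: (proj_vars J s) ((-1) ^+ r) ('X_j ^+ r * b) => v e w E2 sq.
  have -> : f * (e * (w - v * g)) = e * (f * w - f * v * g) by ring.
  rewrite -E2; have -> : e * (v * (e + f * g) - f * v * g) = v * (e * e) by ring.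
  by rewrite sq mulr1.
have /(congr1 (split_var j)) := sE.
rewrite split_var_const // (rmorphM (split_var j)) /f (rmorphD (split_var j)).
rewrite (rmorphM (split_var j)) rmorph1 /= split_varX eqxx /=.
have cj0 : split_var j c != 0 by apply: contra c0 => /eqP c0; apply/eqP/(@split_var_inj j); rewrite rmorph0.
have sf : (1 < size (1 + 'X * split_var j c)%R)%N.
  have sX : size ('X * split_var j c) = (size (split_var j c)).+1 by rewrite mulrC size_mulX.
  by rewrite addrC size_polyDl sX ?size_poly1 ltnS size_poly_gt0.
have f0 : 1 + 'X * split_var j c != 0 by rewrite -size_poly_gt0 ltnW.
have b0 : split_var j b' != 0.
  apply: contra s0 => /eqP b0; rewrite sE (_ : b' = 0) ?mulr0 //.
  by apply: (@split_var_inj j); rewrite b0 rmorph0.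
move/(congr1 (fun p : {poly R} => size p)); rewrite size_polyC s0 size_mul //.
move: b0; rewrite -size_poly_gt0; case: (size _) sf => [|[|m]] // _.
by case: (size _) => // m' _; rewrite !addSn /= addnS.
Qed.

(* Let [c] be a common denominator of all [x_i] and [x_i^-1] over [K[x_J]].  As [f = 1 + x_j c] is prime
   to [c] and has positive degree in [x_j], no nonzero polynomial in the variables [J :\ j] times a
   monomial becomes divisible by [f] modulo [Q]; enlarge [Q + (f)] to a prime avoiding them all. *)
Lemma prime_above Q J j : comm_prime Q -> (forall i, ~ Q 'X_i) ->
  max_indep Q J -> j \in J ->
  exists Q', [/\ comm_prime Q', forall p, Q p -> Q' p, exists2 f, Q' f & ~ Q f,
    forall i, ~ Q' 'X_i & indep Q' (J :\ j)].
Proof.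
move=> Qp QX Jmax jJ; have [F [phi Qphi]] := prime_point Qp.
have [c0 nzc bd] := max_indep_denominator Qphi Jmax.
have iJ := Jmax.1; have [Qi Q1 _] := Qp.
set c := proj_vars J c0; have cE : proj_vars J c = c by apply: proj_vars_sub.
have c_n0 : c != 0 by apply: contraNneq nzc => c00; rewrite /= -/c c00 rmorph0.
pose f : R := 1 + 'X_j * c.
have fE : proj_vars J f = f by rewrite rmorphD rmorph1 rmorphM /= proj_varsX jJ cE.
pose I (p : R) := exists q g : R, Q q /\ p = q + f * g.
pose S (p : R) := exists (s : R) (m : 'X_{1..n}), proj_vars (J :\ j) s != 0 /\ p = proj_vars (J :\ j) s * 'X_[m].
have Iid : is_ideal I.
  case: (Qi) => Q0 QD QM QM'; split.
  - by exists 0, 0; rewrite mulr0 addr0.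
  - move=> _ _ [q [g [Qq ->]]] [q' [g' [Qq' ->]]]; exists (q + q'), (g + g').
    by split; [apply: QD | ring].
  - by move=> r _ [q [g [Qq ->]]]; exists (r * q), (r * g); split; [apply: QM | ring].
  - by move=> r _ [q [g [Qq ->]]]; exists (q * r), (r * g); split; [apply: QM' | ring].
have S1 : S 1 by exists 1, 0%MM; rewrite rmorph1 oner_eq0 mpolyX0 mulr1.
have SM a b : S a -> S b -> S (a * b).
  move=> [s [m [s0 ->]]] [s' [m' [s'0 ->]]]; exists (s * s'), (m + m')%MM.
  by rewrite rmorphM mulf_neq0 // mpolyXD; split=> //; ring.
have IS a : I a -> ~ S a.
  move=> [q [g [Qq ->]]] [s [m [s0 E]]].
  set s' := proj_vars (J :\ j) s in s0 E.
  have s'E : proj_vars J s' = s' by apply: proj_vars_sub; apply: subsetDl.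
  have X0 : phi 'X_[m] != 0.
    rewrite (mpolyXE_id _ m) rmorph_prod; apply/prodf_neq0 => i _.
    rewrite rmorphXn expf_neq0 //; apply/eqP => /Qphi; exact: QX.
  have [_ /(_ m)[r [P monP rP]]] := bd g.
  set h := _ * _ in rP.
  have hE : phi f * h = phi (s' * c ^+ r).
    have /(congr1 phi) := E; rewrite rmorphD !rmorphM (iffLR (Qphi q) Qq) add0r => E'.
    rewrite /h mulrCA [phi f * _]mulrA E' mulfK // /= -/c rmorphXn mulrC.
    by [].
  set a' := s' * c ^+ r in hE.
  have a'E : proj_vars J a' = a' by rewrite rmorphM rmorphXn /= s'E cE.
  (* [T] is the integral equation of [h] multiplied by [f ^+ d.-1], with [f * h] replaced by [a'].
     It lies in K[x_J] and in [Q], hence vanishes; all its terms but the leading [a' ^+ d.-1] are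
     multiples of [f]. *)
  set d := size P; pose T := \sum_(k < d) proj_vars J P`_k * f ^+ (d.-1 - k) * a' ^+ k.
  have T0 : T = 0.
    have <- : proj_vars J T = T.
      rewrite rmorph_sum; apply: eq_bigr => k _.
      by rewrite !rmorphM !rmorphXn /= fE a'E proj_vars_sub.
    apply: iJ; apply/Qphi; rewrite (rmorph_sum (proj_vars J)) (rmorph_sum phi).
    move/eqP: rP; rewrite horner_coef size_map_poly_id0; last first.
      by rewrite (monicP monP) rmorph1 oner_eq0.
    move/(congr1 (fun v => phi f ^+ d.-1 * v)); rewrite mulr0 mulr_sumr => E0; rewrite -[RHS]E0.
    apply: eq_bigr => k _; rewrite !rmorphM !rmorphXn /= fE a'E proj_vars_sub //.
    rewrite -hE exprMn coef_map /= !mulrA; congr (_ * _).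
    rewrite -mulrA -exprD subnK 1?mulrC //.
    by rewrite -ltnS prednK ?(ltn_ord k) // (leq_ltn_trans _ (ltn_ord k)).
  have d0 : (0 < d)%N by rewrite size_poly_gt0 monic_neq0.
  have : exists b, a' ^+ d.-1 = f * b.
    rewrite /T in T0; clear T; move: T0; move: (monicP monP); rewrite /lead_coef -/d.
    clearbody d; case: d d0 => // d _ /= lP; rewrite big_ord_recr /= lP rmorph1 subnn expr0 !mul1r.
    move/eqP; rewrite addrC addr_eq0 => /eqP->.
    exists (- \sum_(k < d) proj_vars J P`_k * f ^+ (d - k).-1 * a' ^+ k).
    rewrite mulrN mulr_sumr; congr (- _); apply: eq_bigr => k _.
    have -> : (d - k)%N = (d - k).-1.+1 by rewrite prednK // subn_gt0.
    by rewrite exprS /=; ring.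
  case=> b; rewrite /a' exprMn -exprM -rmorphXn /=; apply: not_dvd_var_free => //.
    by rewrite !inE eqxx.
  by rewrite rmorphXn expf_neq0.
have [Q' [Q'p IQ' Q'S]] := prime_avoiding Iid S1 SM IS.
exists Q'; split=> //.
- by move=> p Qq; apply: IQ'; exists p, 0; rewrite mulr0 addr0.
- exists f; first by apply: IQ'; exists 0, 1; rewrite add0r mulr1; split=> //; case: Qi.
  (* An element of K[x_J] in [Q] is zero, but [f] takes the value 1 at the origin. *)
  rewrite -fE => /iJ; rewrite fE /f => f0.
  have := congr1 (mmap idfun (fun _ => 0)) f0.
  rewrite rmorphD rmorphM rmorph1 rmorph0 /= mmapX mmap1U mul0r addr0.
  by move/eqP; rewrite oner_eq0.
- by move=> i /Q'S; apply; exists 1, U_(i)%MM; rewrite rmorph1 oner_eq0 mul1r.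
- move=> p /Q'S nS; apply: contrapT => /eqP s0; apply: nS; exists p, 0%MM.
  by rewrite mpolyX0 mulr1.
Qed.
End GoingUp.

(** * Chains of primes *)

Section Steps.
Variable R : pzRingType.
Implicit Types (G : (R -> Prop) -> Prop) (a b c : R -> Prop).

(** The inductive form lets chains be concatenated and transported with their end points tracked;
    [G] confines all members to a class of ideals, such as the torus primes. *)
Inductive steps G : nat -> (R -> Prop) -> (R -> Prop) -> Prop :=
| steps0 a : G a -> steps G 0 a a
| stepsS m a b c : G a -> strict_sub a b -> steps G m b c -> steps G m.+1 a c.

Lemma same_ideal_eq a b : same_ideal a b -> a = b.
Proof. by move=> E; apply/funext => r; apply/propext; apply: E. Qed.

Lemma steps_trans G m k a b c : steps G m a b -> steps G k b c -> steps G (m + k) a c.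
Proof. by elim=> // {}m a' b' c' Ga ab _ IH /IH; apply: stepsS. Qed.

Lemma steps_ends G m a b : steps G m a b -> G a /\ G b.
Proof. by elim=> // {}m a' b' c' Ga _ _ []. Qed.

Lemma steps_rcons G m a b c : steps G m a b -> strict_sub b c -> G c -> steps G m.+1 a c.
Proof.
move=> ab bc Gc; rewrite -addn1; have [_ Gb] := steps_ends ab.
exact: steps_trans ab (stepsS Gb bc (steps0 Gc)).
Qed.

Lemma steps_rank G (r : (R -> Prop) -> nat) m a b :
  (forall a b, G a -> G b -> strict_sub a b -> (r b < r a)%N) ->
  steps G m a b -> (m + r b <= r a)%N.
Proof.
move=> rG; elim=> // {}m a' b' c' Ga ab bc IH.
by rewrite addSn (leq_ltn_trans IH) // rG //; case: (steps_ends bc).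
Qed.

Lemma steps_chain m a b : steps (@is_prime R) m a b ->
  exists ch, [/\ prime_chain ch m, ch 0%N = a & ch m = b].
Proof.
elim=> [{}a pa|{}m {}a {}b d pa ab _ [c [[cp cs] c0 cm]]].
  by exists (fun=> a).
exists (fun i => if i is i'.+1 then c i' else a); split=> //.
split=> [[|i]|[|i]] //; rewrite ?ltnS => H; [exact: (cp i H)|by rewrite c0|exact: (cs i H)].
Qed.

Lemma chain_steps ch m : prime_chain ch m -> steps (@is_prime R) m (ch 0%N) (ch m).
Proof.
elim: m ch => [|m IH] ch [cp cs]; first by apply/steps0/(cp 0%N).
apply: stepsS (cs 0%N _) _ => //; first exact: (cp 0%N).
by apply: (IH (fun i => ch i.+1)); split=> i H; [exact: (cp i.+1 H)|exact: (cs i.+1 H)].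
Qed.

(* A chain of the maximal possible length [N] through [p] forces all lengths to be exact. *)
Lemma height_coheight (r : (R -> Prop) -> nat) N p h k a b :
  (forall a b, is_prime a -> is_prime b -> strict_sub a b -> (r b < r a)%N) ->
  (forall a, is_prime a -> (r a <= N)%N) ->
  steps (@is_prime R) h a p -> steps (@is_prime R) k p b -> (h + k = N)%N ->
  [/\ height_is p h, coheight_is p k & kdim_is R N].
Proof.
move=> rlt rN ap pb hk.
have bound m a' b' : steps (@is_prime R) m a' b' -> (m <= N)%N.
  move=> s; apply: leq_trans (rN _ (steps_ends s).1).
  by apply: leq_trans (steps_rank rlt s); apply: leq_addr.
split; split.
- by have [c [cp _ cm]] := steps_chain ap; exists c; rewrite cm.
- move=> c m /chain_steps s /same_ideal_eq E; rewrite E in s.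
  by have := bound _ _ _ (steps_trans s pb); rewrite -hk leq_add2r.
- by have [c [cp c0 _]] := steps_chain pb; exists c; rewrite c0.
- move=> c m /chain_steps s /same_ideal_eq E; rewrite E in s.
  by have := bound _ _ _ (steps_trans ap s); rewrite -hk leq_add2l.
- by have [c [cp _ _]] := steps_chain (steps_trans ap pb); exists c; rewrite -hk.
- by move=> c m /chain_steps/bound.
Qed.
End Steps.

Lemma steps_map (R R' : pzRingType) G G' (f : (R -> Prop) -> (R' -> Prop)) m a b :
  (forall a, G a -> G' (f a)) ->
  (forall a b, G a -> G b -> strict_sub a b -> strict_sub (f a) (f b)) ->
  steps G m a b -> steps G' m (f a) (f b).
Proof.
move=> fG fs; elim=> [{}a Ga|{}m {}a {}b c Ga ab bc IH]; first by apply/steps0/fG.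
apply: stepsS IH; first exact: fG.
by apply: fs => //; case: (steps_ends bc).
Qed.

Section TorusPrimes.
Variables (K : fieldType) (n : nat).
Local Notation R := {mpoly K[n]}.
Implicit Types (S J : {set 'I_n}) (Q : R -> Prop).

(* The primes of Laurent polynomials in the variables [S], contracted to polynomials; the variables
   outside [S] are specialised to 1. *)
Definition torus_prime S Q := [/\ comm_prime Q, forall i, ~ Q 'X_i &
  forall i, i \notin S -> Q ('X_i - 1)].

Lemma torus_indep_sub S Q J : torus_prime S Q -> indep Q J -> J \subset S.
Proof.
move=> [_ _ QS] iJ; apply/subsetP => i iJ'; apply: contraT => /QS Qi.
have E : proj_vars J ('X_i - 1 : R) = 'X_i - 1 by rewrite rmorphB rmorph1 /= proj_varsX iJ'.
have := iJ ('X_i - 1); rewrite E => /(_ Qi)/eqP; rewrite subr_eq0 => /eqP.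
move/(congr1 (mmap idfun (fun _ => 0))).
by rewrite rmorph1 /= mmapX mmap1U => /eqP; rewrite eq_sym oner_eq0.
Qed.

Lemma torus_trdeg S Q : torus_prime S Q -> (trdeg Q <= #|S|)%N.
Proof.
move=> tQ; have [[Qi Q1 _] _ _] := tQ; have [J iJ <-] := trdegP Qi Q1.
exact/subset_leq_card/torus_indep_sub/iJ.
Qed.

Lemma torus_poly_ext S i Q : torus_prime S Q -> torus_prime (i |: S) (poly_ext i Q).
Proof.
move=> [Qp QX QS]; have [Qi _ _] := Qp; split; first exact: poly_ext_prime.
  by move=> k /poly_ext_sub-/(_ Qi); apply: QX.
move=> k; rewrite !inE negb_or => /andP[ki kS]; rewrite -mpolyC1.
by apply/poly_ext_var_other => //; rewrite mpolyC1; apply: QS.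
Qed.

Lemma torus_steps_below S Q J : torus_prime S Q -> max_indep Q J ->
  exists Q0, steps (torus_prime S) #|S :\: J| Q0 Q.
Proof.
move: {2}#|S :\: J| (erefl #|S :\: J|) => m; elim: m Q J => [|m IH] Q J Sm tQ Jmax.
  by rewrite Sm; exists Q; apply: steps0.
have /card_gt0P[i] : (0 < #|S :\: J|)%N by rewrite Sm.
rewrite inE => /andP[iJ iS]; have [Qp QX QS] := tQ; have [Qi Q1 _] := Qp.
have tE : torus_prime S (poly_ext i Q).
  by have := torus_poly_ext i tQ; rewrite (setUidPr _) ?sub1set.
have cE : #|S :\: (i |: J)| = m.
  have := cardsD1 i (S :\: J); rewrite Sm !inE iJ iS add1n => -[->].
  by congr #|pred_of_set _|; apply/setP => k; rewrite !inE negb_or andbA.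
have [Q0 s] := IH _ _ cE tE (poly_ext_max_indep Qp iJ Jmax).
exists Q0; rewrite Sm -cE; apply: steps_rcons s _ tQ.
split; first by move=> p; apply: poly_ext_sub.
(* The inclusion is strict: a relation that makes [i |: J] dependent modulo [Q] is lost in
   [poly_ext i Q], for which [i |: J] is independent. *)
have /existsNP[p /not_implyP[Qp' nz]] := Jmax.2 i iJ.
exists (proj_vars (i |: J) p); split=> // /(proj1 (poly_ext_max_indep Qp iJ Jmax)).
exact: nz.
Qed.

(** The inequality on [m] lets the induction proceed with any maximal independent set containing
    [J :\ j], without computing its size. *)
Lemma torus_steps_above S Q J m : torus_prime S Q -> max_indep Q J -> (m <= #|J|)%N ->
  exists Q', steps (torus_prime S) m Q Q'.
Proof.
elim: m Q J => [|m IH] Q J tQ Jmax mJ; first by exists Q; apply: steps0.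
have /card_gt0P[j jJ] : (0 < #|J|)%N by apply: leq_trans mJ.
have [Qp QX QS] := tQ.
have [Q1 [Q1p QQ1 [f Q1f Qf] Q1X /indep_extend[J1 sJ1 J1max]]] := prime_above Qp QX Jmax jJ.
have tQ1 : torus_prime S Q1 by split=> // i /QS/QQ1.
have [|Q' s] := IH Q1 J1 tQ1 J1max.
  by apply: leq_trans (subset_leq_card sJ1); move: mJ; rewrite (cardsD1 j J) jJ.
by exists Q'; apply: stepsS tQ _ s; split=> //; exists f.
Qed.
End TorusPrimes.

(** * Laurent polynomials *)

Section Subalgebra.
Variables (K : fieldType) (n : nat) (A : algType K) (x y : 'I_n -> A) (N : {set 'I_n}).

Definition subalg_pred : {pred A} := fun a => `[< subalg x y N a >].

Fact subalg_pred_closed : subalg_closed subalg_pred.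
Proof.
split=> [|k a b /asboolP Pa /asboolP Pb|a b /asboolP Pa /asboolP Pb]; apply/asboolP.
- exact: subalg_1.
- by apply: subalg_add => //; apply: subalg_scale.
- exact: subalg_mul.
Qed.
HB.instance Definition _ := GRing.isSubalgClosed.Build K A subalg_pred subalg_pred_closed.

Record subalg_type := SubAlg { subalg_val : A; _ : subalg_val \in subalg_pred }.
HB.instance Definition _ := [isSub for subalg_val].
HB.instance Definition _ := [Choice of subalg_type by <:].
HB.instance Definition _ := [SubChoice_isSubAlgebra of subalg_type by <:].

Lemma subalg_type_x i (iN : i \in N) : x i \in subalg_pred.
Proof. exact/asboolP/subalg_x. Qed.

Lemma subalg_type_y i (iN : i \in N) : y i \in subalg_pred.
Proof. exact/asboolP/subalg_y. Qed.

Lemma subalg_val_hom : is_alg_hom subalg_val.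
Proof. by []. Qed.

Lemma is_alg_hom_comp (B C : algType K) (f : A -> B) (g : B -> C) :
  is_alg_hom f -> is_alg_hom g -> is_alg_hom (g \o f).
Proof.
move=> [fD fM f1 fZ] [gD gM g1 gZ]; split=> /= *.
- by rewrite fD gD.
- by rewrite fM gM.
- by rewrite f1 g1.
- by rewrite fZ gZ.
Qed.
End Subalgebra.

Section ComSubalgebra.
Variables (K : fieldType) (n : nat) (L : comAlgType K) (t u : 'I_n -> L) (S : {set 'I_n}).
HB.instance Definition _ := [SubNzRing_isSubComNzRing of subalg_type t u S by <:].
End ComSubalgebra.

Section Generation.
Variables (K : fieldType) (n : nat).

(** The universal property maps [A] to the subalgebra of the generators; followed by the inclusion,
    this is the identity by uniqueness. *)
Lemma presents_Sn_gen (A : algType K) (x y : 'I_n -> A) : presents_Sn x y ->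
  forall a, subalg x y [set: 'I_n] a.
Proof.
move=> [[yx xyC] uni] a.
pose X i : subalg_type x y setT := SubAlg (subalg_type_x x y (in_setT i)).
pose Y i : subalg_type x y setT := SubAlg (subalg_type_y x y (in_setT i)).
have XY : jacobson_rels X Y.
  split=> [i|i j /xyC[E1 E2 E3]]; first exact/val_inj/yx.
  by split; apply: val_inj.
have [[f [fh fE]] _] := uni _ X Y XY.
have [_ ext] := uni A x y (conj yx xyC).
have -> : a = subalg_val (f a).
  apply: (ext idfun (@subalg_val _ _ _ x y setT \o f)) => //.
    exact: is_alg_hom_comp fh (subalg_val_hom _ _ _).
  by move=> i /=; have [-> ->] := fE i.
by case: (f a) => b bP; exact: asboolW bP.
Qed.

Lemma presents_Laurent_gen (L : comAlgType K) (t u : 'I_n -> L) (S : {set 'I_n}) :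
  presents_Laurent S t u -> forall a, subalg t u S a.
Proof.
move=> [tu uni] a.
(* Only for [i] in [S] is [t i] known to lie in the subalgebra; elsewhere, where no relation is
   imposed, the value may default to 1. *)
pose X i : subalg_type t u S := insubd 1 (t i).
pose Y i : subalg_type t u S := insubd 1 (u i).
have XE i : i \in S -> val (X i) = t i.
  by move=> iS; rewrite val_insubd subalg_type_x.
have YE i : i \in S -> val (Y i) = u i.
  by move=> iS; rewrite val_insubd subalg_type_y.
have XY i : i \in S -> X i * Y i = 1.
  by move=> iS; apply: val_inj; rewrite /= -(tu i iS) -XE // -YE.
have [[f [fh fE]] _] := uni _ X Y XY.
have [_ ext] := uni L t u tu.
have -> : a = subalg_val (f a).
  apply: (ext idfun (@subalg_val _ _ _ t u S \o f)) => //.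
    exact: is_alg_hom_comp fh (subalg_val_hom _ _ _).
  by move=> i iS /=; have [-> _] := fE i iS; rewrite [RHS]XE.
by case: (f a) => b bP; exact: asboolW bP.
Qed.
End Generation.

Lemma steps_lift (R R' : pzRingType) (G : (R -> Prop) -> Prop) (G' : (R' -> Prop) -> Prop)
    (g : (R' -> Prop) -> (R -> Prop)) m a b :
  (forall a, G a -> exists2 a', G' a' & g a' = a) ->
  (forall a b, G' a -> G' b -> strict_sub (g a) (g b) -> strict_sub a b) ->
  steps G m a b -> exists a' b', [/\ steps G' m a' b', g a' = a & g b' = b].
Proof.
move=> gG gs; elim=> [{}a /gG[a' Ga' aE]|{}m {}a {}b c Ga ab bc [b' [c' [s bE cE]]]].
  by exists a', a'; split=> //; apply: steps0.
have [a' Ga' aE] := gG a Ga; exists a', c'; split=> //.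
have [Gb' _] := steps_ends s.
by apply: stepsS s => //; apply: gs => //; rewrite aE bE.
Qed.

Section FieldAlgebra.
Variables (K F : fieldType) (iota : {rmorphism K -> F}).
(** The idle [let] stores [iota] in the type, so that the algebra structure over [K] can be found
    from it. *)
Definition field_alg : Type := let _ := iota in F.
HB.instance Definition _ := GRing.Field.on field_alg.
Definition field_alg_scale (k : K) (w : field_alg) : field_alg := iota k * (w : F).

Fact field_alg_scaleA k k' w :
  field_alg_scale k (field_alg_scale k' w) = field_alg_scale (k * k') w.
Proof. by rewrite /field_alg_scale rmorphM mulrA. Qed.
Fact field_alg_scale1 : left_id 1 field_alg_scale.
Proof. by move=> w; rewrite /field_alg_scale rmorph1 mul1r. Qed.
Fact field_alg_scaleDr : right_distributive field_alg_scale +%R.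
Proof. by move=> k v w; apply: mulrDr. Qed.
Fact field_alg_scaleDl w : {morph field_alg_scale^~ w : a b / a + b}.
Proof. by move=> a b; rewrite /field_alg_scale rmorphD mulrDl. Qed.
HB.instance Definition _ := GRing.Zmodule_isLmodule.Build K field_alg
  field_alg_scaleA field_alg_scale1 field_alg_scaleDr field_alg_scaleDl.

Fact field_alg_scaleAl (k : K) (v w : field_alg) : k *: (v * w) = (k *: v) * w.
Proof. exact: mulrA. Qed.
HB.instance Definition _ := GRing.Lmodule_isLalgebra.Build K field_alg field_alg_scaleAl.
HB.instance Definition _ := GRing.Lalgebra_isComAlgebra.Build K field_alg.
End FieldAlgebra.

Section AlgHom.
Variables (K : fieldType) (A B : algType K) (f : A -> B).

Definition alg_hom_fun of is_alg_hom f : A -> B := f.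
Variable fh : is_alg_hom f.

Fact alg_hom_additive : zmod_morphism (alg_hom_fun fh).
Proof.
have [fD _ _ fZ] := fh => a b.
by rewrite /alg_hom_fun -scaleN1r fD fZ scaleN1r.
Qed.
Fact alg_hom_multiplicative : monoid_morphism (alg_hom_fun fh).
Proof. by have [_ fM f1 _] := fh. Qed.
HB.instance Definition _ := GRing.isZmodMorphism.Build A B (alg_hom_fun fh) alg_hom_additive.
HB.instance Definition _ :=
  GRing.isMonoidMorphism.Build A B (alg_hom_fun fh) alg_hom_multiplicative.
End AlgHom.

Section Laurent.
Variables (K : fieldType) (n : nat) (S : {set 'I_n}) (L : comAlgType K) (t u : 'I_n -> L).
Hypothesis HL : presents_Laurent S t u.
Local Notation R := {mpoly K[n]}.
Implicit Types (q : L -> Prop) (Q : R -> Prop).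

Definition laurent_eval : R -> L := mmap (in_alg L) (fun i => if i \in S then t i else 1).
HB.instance Definition _ := GRing.RMorphism.on laurent_eval.

Lemma laurent_evalX i : laurent_eval 'X_i = if i \in S then t i else 1.
Proof. by rewrite /laurent_eval mmapX mmap1U. Qed.

Lemma laurent_evalC c : laurent_eval c%:MP = c%:A.
Proof. exact: mmapC. Qed.

Definition contract q : R -> Prop := fun p => q (laurent_eval p).

Lemma laurent_clear (a : L) : exists (m : 'X_{1..n}) p,
  laurent_eval 'X_[m] * a = laurent_eval p.
Proof.
elim: (presents_Laurent_gen HL a) => {a}.
- by move=> i iS; exists 0%MM, 'X_i; rewrite mpolyX0 rmorph1 mul1r laurent_evalX iS.
- move=> i iS; exists U_(i)%MM, 1.
  by rewrite rmorph1 [laurent_eval _]laurent_evalX iS; case: HL => ->.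
- by exists 0%MM, 1; rewrite mpolyX0 rmorph1 mul1r.
- move=> a b _ [m [p E]] _ [m' [p' E']]; exists (m + m')%MM, ('X_[m'] * p + 'X_[m] * p').
  by rewrite mpolyXD rmorphD !rmorphM /= -E -E'; ring.
- move=> a b _ [m [p E]] _ [m' [p' E']]; exists (m + m')%MM, (p * p').
  by rewrite mpolyXD !rmorphM /= -E -E'; ring.
- move=> k a _ [m [p E]]; exists m, (k%:MP * p).
  by rewrite rmorphM /= laurent_evalC -E mulrCA mulr_algl.
Qed.

Lemma laurent_monomial_unit (m : 'X_{1..n}) : exists v, v * laurent_eval 'X_[m] = 1.
Proof.
rewrite (mpolyXE_id _ m) rmorph_prod.
apply: (big_ind (fun w => exists v, v * w = 1)) => [|a b [v va] [w wb]|i _].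
- by exists 1; rewrite mul1r.
- by exists (v * w); rewrite mulrACA va wb mulr1.
- rewrite rmorphXn /= laurent_evalX; case: ifP => [iS|_].
    by exists (u i ^+ m i); rewrite -exprMn mulrC; case: HL => -> //; rewrite expr1n.
  by exists 1; rewrite expr1n mulr1.
Qed.

Lemma contract_torus q : is_prime q -> torus_prime S (contract q).
Proof.
move=> /is_prime_comm qp; have [F [f qf]] := prime_point qp; have [[q0 _ qM _] q1 _] := qp.
split.
- by apply: (ker_comm_prime (f := f \o laurent_eval)) => p; apply: qf.
- move=> i Qi; have [v vX] := laurent_monomial_unit U_(i); apply: q1.
  by rewrite -vX; apply: qM.
- by move=> i iS; rewrite /contract rmorphB rmorph1 /= laurent_evalX (negbTE iS) subrr.
Qed.

Lemma contract_le q q' : is_prime q -> is_prime q' ->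
  (forall p, contract q p -> contract q' p) -> forall a, q a -> q' a.
Proof.
move=> [[_ _ qM _] _ _] [[_ _ q'M _] _ _] sub a qa.
have [m [p E]] := laurent_clear a; have [v vX] := laurent_monomial_unit m.
rewrite -[a]mul1r -vX -mulrA; apply: (q'M); rewrite E; apply: sub.
by rewrite /contract -E; apply: qM.
Qed.

Lemma contract_strict q q' : is_prime q -> is_prime q' ->
  strict_sub (contract q) (contract q') <-> strict_sub q q'.
Proof.
move=> qp qp'; split=> -[sub [a [q'a qa]]].
  split; first exact: contract_le.
  by exists (laurent_eval a).
split; first by move=> p; apply: sub.
apply: contrapT => nex; apply: qa; move: a q'a; apply: contract_le => // p Qp.
by apply: contrapT => nQp; apply: nex; exists p.
Qed.

(** No variable vanishes at the point of [Q], so the universal property extends this point to [L];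
    the kernel of the extension contracts to [Q]. *)
Lemma contract_onto Q : torus_prime S Q -> exists2 q, is_prime q & contract q = Q.
Proof.
move=> [Qp QX QS]; have [F [phi Qphi]] := prime_point Qp.
pose iota : {rmorphism K -> F} := phi \o @mpolyC n K.
pose z i : field_alg iota := phi 'X_i.
have z0 i : z i != 0 by apply/eqP => /Qphi; apply: QX.
have [_ /(_ (field_alg iota) z (fun i => (z i)^-1))] := HL.
case=> [i iS|[f [fh fE]] _]; first by rewrite divff.
pose h : {rmorphism L -> field_alg iota} := alg_hom_fun fh.
exists (fun a => h a = 0); first exact/comm_is_prime/(ker_comm_prime (f := h)).
have E p : h (laurent_eval p) = phi p.
  apply: (mpoly_morph_ext (f := h \o laurent_eval) (g := phi)) => [c|i] /=.
    rewrite laurent_evalC /h /alg_hom_fun /=; have [_ _ f1 ->] := fh; rewrite f1.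
    exact: mulr1.
  rewrite laurent_evalX; case: ifP => [/fE[]//|/negbT/QS].
  rewrite rmorph1 => /Qphi/eqP; rewrite rmorphB rmorph1 subr_eq0 => /eqP->.
  by [].
by apply: same_ideal_eq => p; rewrite /contract E Qphi.
Qed.

Lemma laurent_steps q J : is_prime q -> max_indep (contract q) J ->
  exists q0 q1, steps (@is_prime L) #|S :\: J| q0 q /\ steps (@is_prime L) #|J| q q1.
Proof.
move=> qp Jmax; have tq := contract_torus qp.
have le a b : is_prime a -> is_prime b -> strict_sub (contract a) (contract b) -> strict_sub a b.
  by move=> ap bp; apply: (contract_strict ap bp).1.
have inj a : is_prime a -> contract a = contract q -> a = q.
  move=> ap E; apply: same_ideal_eq => r; split; apply: contract_le => //.
    by rewrite E.
  by rewrite E.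
have [Q0 /(steps_lift contract_onto le)[q0 [q' [s _ E]]]] := torus_steps_below tq Jmax.
have [Q1 /(steps_lift contract_onto le)[q'' [q1 [s' E' _]]]] := torus_steps_above tq Jmax (leqnn _).
have Eq' := inj _ (steps_ends s).2 E; have Eq'' := inj _ (steps_ends s').1 E'.
by exists q0, q1; rewrite -{1}Eq' -Eq''.
Qed.

Lemma laurent_height q J : is_prime q -> max_indep (contract q) J ->
  height_is q #|S :\: J| /\ coheight_is q #|J|.
Proof.
move=> qp Jmax; have [q0 [q1 [s s']]] := laurent_steps qp Jmax.
have [] // := height_coheight (r := fun q => trdeg (contract q)) (N := #|S|) _ _ s s'.
- move=> a b ap bp; rewrite -(contract_strict ap bp) => -[sub [f [bf af]]].
  have [aQ _ _] := contract_torus ap; have [[bi b1 _] _ _] := contract_torus bp.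
  exact: trdeg_lt bf af.
- by move=> a /contract_torus/torus_trdeg.
- rewrite -(cardsID J S) addnC (setIidPr _) //.
  exact: torus_indep_sub (contract_torus qp) Jmax.1.
Qed.
End Laurent.

(** * Primes of the algebra of one-sided inverses *)

Section CommutingEval.
Variables (K : fieldType) (n : nat) (A : algType K) (z : 'I_n -> A).
Local Notation R := {mpoly K[n]}.

(* [mmap] is only known to be multiplicative when the values are central, whence this copy. *)
Definition comm_eval of (forall i j, GRing.comm (z i) (z j)) : R -> A := mmap (in_alg A) z.
Hypothesis zC : forall i j, GRing.comm (z i) (z j).

Fact comm_eval_additive : zmod_morphism (comm_eval zC).
Proof. exact: (mmapB z (in_alg A)). Qed.
HB.instance Definition _ := GRing.isZmodMorphism.Build R A (comm_eval zC) comm_eval_additive.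

Lemma comm_evalZ c p : comm_eval zC (c *: p) = c *: comm_eval zC p.
Proof. by rewrite /comm_eval mmapZ mulr_algl. Qed.

Lemma comm_evalC c : comm_eval zC c%:MP = c%:A.
Proof. exact: mmapC. Qed.

Lemma comm_evalX i : comm_eval zC 'X_i = z i.
Proof. by rewrite /comm_eval mmapX mmap1U. Qed.

Fact comm_eval_monomialM (m m' : 'X_{1..n}) :
  comm_eval zC ('X_[m] * 'X_[m']) = comm_eval zC 'X_[m] * comm_eval zC 'X_[m'].
Proof.
rewrite -mpolyXD /comm_eval !mmapX /mmap1 -GRing.prodrM_comm.
  by apply: eq_bigr => i _; rewrite mnmDE exprD.
by move=> i j _ _; apply/commrX/commr_sym/commrX.
Qed.

Fact comm_eval_multiplicative : monoid_morphism (comm_eval zC).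
Proof.
split; first by rewrite -[1]/(1%:MP_[n]) comm_evalC scale1r.
move=> p q; rewrite (mpolyE p) (mpolyE q) mulr_suml !raddf_sum mulr_suml.
apply: eq_bigr => m _; rewrite mulr_sumr !raddf_sum mulr_sumr.
apply: eq_bigr => m' _; rewrite -scalerAl -scalerAr /= !comm_evalZ comm_eval_monomialM.
by rewrite -scalerAl -scalerAr.
Qed.
HB.instance Definition _ :=
  GRing.isMonoidMorphism.Build R A (comm_eval zC) comm_eval_multiplicative.
End CommutingEval.

(** Instead of the ideals generated by [a] and [b], the proof takes all [d] with [a * r * d] in [P]
    for every [r], and all [c] that multiply these [d] into [P]. Both are two-sided without any
    finite sums. *)
Lemma is_prime_elt (R : pzRingType) (P : R -> Prop) a b :
  is_prime P -> ~ P a -> ~ P b -> exists r, ~ P (a * r * b).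
Proof.
move=> [[P0 PD PM PM'] P1 Pp] nPa nPb; apply: contrapT => nex.
have ab r : P (a * r * b) by apply: contrapT => nab; apply: nex; exists r.
pose Jd d := forall r, P (a * r * d).
pose I c := forall d, Jd d -> P (c * d).
have Jid : is_ideal Jd.
  split; first by move=> r; rewrite mulr0.
  - by move=> d d' Jd1 Jd2 r; rewrite mulrDr; apply: (PD).
  - by move=> s d H r; rewrite mulrA -(mulrA a); apply: H.
  - by move=> s d H r; rewrite mulrA; apply: (PM'); apply: H.
have Iid : is_ideal I.
  split; first by move=> d _; rewrite mul0r.
  - by move=> c c' Ic Ic' d Hd; rewrite mulrDl; apply: (PD); [apply: Ic|apply: Ic'].
  - by move=> s c Ic d Hd; rewrite -mulrA; apply: (PM); apply: Ic.
  - by move=> s c Ic d Hd; rewrite -mulrA; apply: Ic; case: Jid => _ _ JM _; apply: JM.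
have [//|IP|JP] := Pp I Jd Iid Jid; first by move=> c d Ic Hd; apply: Ic.
  by apply/nPa/IP => d /(_ 1); rewrite mulr1.
exact/nPb/JP.
Qed.

Section JacobsonAlgebra.
Variables (K : fieldType) (n : nat) (A : algType K) (x y : 'I_n -> A).
Hypothesis HA : presents_Sn x y.
Local Notation R := {mpoly K[n]}.
Implicit Types (P : A -> Prop) (J T : {set 'I_n}) (Q : R -> Prop).

Lemma sn_yx i : y i * x i = 1. Proof. by case: HA => -[]. Qed.
Lemma sn_xy_comm i j : i != j -> x i * y j = y j * x i.
Proof. by case: HA => -[_ c] _ /c[]. Qed.
Lemma sn_xx_comm i j : x i * x j = x j * x i.
Proof. by have [->//|] := eqVneq i j; case: HA => -[_ c] _ /c[]. Qed.
Lemma sn_yy_comm i j : y i * y j = y j * y i.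
Proof. by have [->//|] := eqVneq i j; case: HA => -[_ c] _ /c[]. Qed.

Definition sn_idem i := 1 - x i * y i.
Local Notation e := sn_idem.

Lemma sn_idem_x i : e i * x i = 0.
Proof. by rewrite mulrBl mul1r -mulrA sn_yx mulr1 subrr. Qed.
Lemma sn_y_idem i : y i * e i = 0.
Proof. by rewrite mulrBr mulr1 mulrA sn_yx mul1r subrr. Qed.
Lemma sn_idemK i : e i * e i = e i.
Proof. by rewrite {1}/e mulrBl mul1r -mulrA sn_y_idem mulr0 subr0. Qed.

Lemma sn_idem_comm_x i j : i != j -> GRing.comm (x j) (e i).
Proof.
move=> ij; apply: commrB; first exact: commr1.
by apply: commrM; [apply: sn_xx_comm | apply: sn_xy_comm; rewrite eq_sym].
Qed.
Lemma sn_idem_comm_y i j : i != j -> GRing.comm (y j) (e i).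
Proof.
move=> ij; apply: commrB; first exact: commr1.
by apply: commrM; [apply/esym/sn_xy_comm | apply: sn_yy_comm].
Qed.

Lemma subalg_comm T a c : (forall j, j \in T -> GRing.comm a (x j)) ->
  (forall j, j \in T -> GRing.comm a (y j)) -> subalg x y T c -> GRing.comm a c.
Proof.
move=> cx cy; elim=> //.
- exact: commr1.
- by move=> b d _ cb _ cd; apply: commrD.
- by move=> b d _ cb _ cd; apply: commrM.
- by move=> k b _ cb; rewrite /GRing.comm -scalerAr cb scalerAl.
Qed.

Lemma subalg_sub T T' a : T \subset T' -> subalg x y T a -> subalg x y T' a.
Proof.
move=> /subsetP sT; elim=> {a}.
- by move=> i /sT; apply: subalg_x.
- by move=> i /sT; apply: subalg_y.
- exact: subalg_1.
- by move=> a b _ Ha _ Hb; apply: subalg_add.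
- by move=> a b _ Ha _ Hb; apply: subalg_mul.
- by move=> k a _ Ha; apply: subalg_scale.
Qed.

Lemma subalg0 T : subalg x y T 0.
Proof. by rewrite -(scale0r 1); apply/subalg_scale/subalg_1. Qed.

Lemma sn_idem_subalg T i a : i \notin T -> subalg x y T a -> GRing.comm (e i) a.
Proof.
move=> iT; apply: subalg_comm => j jT; apply/commr_sym.
  by apply: sn_idem_comm_x; apply: contraNneq iT => ->.
by apply: sn_idem_comm_y; apply: contraNneq iT => ->.
Qed.

(** This is the spanning family of monomials in [x i], [y i] with coefficients from the other tensor
    factors. Between two copies of [e i] only k = l = 0 survives, since [e i * x i = 0] and
    [y i * e i = 0]. *)
Inductive normal_form i T : A -> Prop :=
| normal_form0 : normal_form i T 0
| normal_formD a b : normal_form i T a -> normal_form i T b -> normal_form i T (a + b)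
| normal_form_mon k l b : subalg x y (T :\ i) b -> normal_form i T (x i ^+ k * b * y i ^+ l).

Lemma normal_formM i T a c : subalg x y T a -> normal_form i T c -> normal_form i T (a * c).
Proof.
move=> Ta; elim: Ta c => {a}.
- move=> j jT c; elim=> {c}.
  + by rewrite mulr0; apply: normal_form0.
  + by move=> a b _ Ha _ Hb; rewrite mulrDr; apply: normal_formD.
  + move=> k l b Tb; rewrite !mulrA; have [->|ji] := eqVneq j i.
      by rewrite -exprS; apply: normal_form_mon.
    rewrite (commrX k (sn_xx_comm j i)) -(mulrA (x i ^+ k)); apply: normal_form_mon.
    by apply: subalg_mul => //; apply: subalg_x; rewrite !inE ji.
- move=> j jT c; elim=> {c}.
  + by rewrite mulr0; apply: normal_form0.
  + by move=> a b _ Ha _ Hb; rewrite mulrDr; apply: normal_formD.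
  + move=> k l b Tb; rewrite !mulrA; have [->|ji] := eqVneq j i.
      case: k => [|k]; last first.
        by rewrite exprS mulrA sn_yx mul1r; apply: normal_form_mon.
      have yb : GRing.comm (y i) b.
        apply: subalg_comm Tb => k; rewrite !inE => /andP[ki _].
          by apply/esym/sn_xy_comm.
        exact: sn_yy_comm.
      rewrite expr0 mulr1 yb -mulrA -exprS -[b]mul1r -(expr0 (x i)).
      exact: normal_form_mon.
    rewrite (commrX k (esym (sn_xy_comm _))) 1?eq_sym // -(mulrA (x i ^+ k)).
    by apply: normal_form_mon; apply: subalg_mul => //; apply: subalg_y; rewrite !inE ji.
- by move=> c; rewrite mul1r.
- by move=> a b _ Ha _ Hb c Hc; rewrite mulrDl; apply: normal_formD; [apply: Ha|apply: Hb].
- by move=> a b _ Ha _ Hb c Hc; rewrite -mulrA; apply/Ha/Hb.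
- move=> k a _ Ha c /Ha; rewrite -scalerAl; elim.
  + by rewrite scaler0; apply: normal_form0.
  + by move=> a' b' _ H1 _ H2; rewrite scalerDr; apply: normal_formD.
  + move=> k' l' b Tb; rewrite scalerAl scalerAr; apply: normal_form_mon.
    exact: subalg_scale.
Qed.

Lemma subalg_normal_form i T a : subalg x y T a -> normal_form i T a.
Proof.
move=> /normal_formM H; rewrite -[a]mulr1; apply: H.
rewrite -[1]mulr1 -{2}(expr0 (y i)) -[1]mulr1 -{1}(expr0 (x i)).
exact/normal_form_mon/subalg_1.
Qed.

Lemma sn_corner i T a : subalg x y T a ->
  exists2 b, subalg x y (T :\ i) b & e i * a * e i = e i * b.
Proof.
move/(subalg_normal_form i); elim=> {a}.
- by exists 0; rewrite ?mulr0 ?mul0r //; apply: subalg0.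
- move=> a b _ [a' Ta aE] _ [b' Tb bE]; exists (a' + b'); first exact: subalg_add.
  by rewrite (mulrDr _ a) mulrDl aE bE mulrDr.
- move=> k l b Tb.
  case: k => [|k]; last first.
    by exists 0; rewrite ?mulr0 ?exprS ?mulrA ?sn_idem_x ?mul0r //; apply: subalg0.
  case: l => [|l]; last first.
    exists 0; rewrite ?mulr0 ?exprSr -?mulrA ?sn_y_idem ?mulr0 //; exact: subalg0.
  exists b; rewrite // !expr0 mul1r mulr1 -mulrA -(sn_idem_subalg _ Tb) ?mulrA ?sn_idemK //.
  by rewrite !inE eqxx.
Qed.

Definition sn_idems (s : seq 'I_n) := \prod_(i <- s) e i.

Lemma sn_idem_idem_comm i j : GRing.comm (e i) (e j).
Proof.
have [->//|ij] := eqVneq i j; apply/commr_sym; apply: commrB; first exact: commr1.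
by apply/commr_sym/commr_sym; apply: commrM; apply/commr_sym;
  [apply: sn_idem_comm_x|apply: sn_idem_comm_y]; rewrite eq_sym.
Qed.

Lemma sn_idems_comm i s : GRing.comm (e i) (sn_idems s).
Proof. by apply: commr_prod => j _; apply: sn_idem_idem_comm. Qed.

Lemma sn_corners s T a : subalg x y T a ->
  exists2 b, subalg x y (T :\: [set i in s]) b & sn_idems s * a * sn_idems s = sn_idems s * b.
Proof.
elim: s => [|i s IH] Ta.
  by exists a; rewrite /sn_idems ?big_nil ?mul1r ?mulr1 // setD0.
have [b Tb bE] := IH Ta; have [c Tc cE] := sn_corner i Tb; exists c.
  apply: subalg_sub Tc; apply/subsetP => j; rewrite !inE negb_or andbA.
  by [].
have -> : sn_idems (i :: s) = e i * sn_idems s by rewrite /sn_idems big_cons.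
have iE := sn_idems_comm i s.
transitivity (e i * (sn_idems s * a * sn_idems s) * e i).
  by rewrite {2}iE !mulrA.
by rewrite bE mulrA iE -!mulrA (mulrA (e i) b) cE.
Qed.
End JacobsonAlgebra.

Lemma card_setC_sub (T : finType) (J J' : {set T}) : J \subset J' ->
  #|~: J| = (#|~: J'| + #|J' :\: J|)%N.
Proof.
move=> /subsetP sJ; rewrite addnC -(cardsID J' (~: J)).
congr (_ + _)%N; apply: eq_card => i; rewrite !inE; first by rewrite andbC.
by case: (boolP (i \in J)) => [/sJ->|]; rewrite ?andbT.
Qed.

Section JacobsonPrimes.
Variables (K : fieldType) (n : nat) (A : algType K) (x y : 'I_n -> A).
Hypothesis HA : presents_Sn x y.
Local Notation R := {mpoly K[n]}.
Local Notation e := (sn_idem x y).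
Implicit Types (P : A -> Prop) (J T : {set 'I_n}) (Q : R -> Prop).

(** Primeness gives [r] with [e i * r * c] outside [P]. In the normal form of [r], terms with k > 0
    are killed by [e i], and the others become [b * (e i * c) * y i ^+ l]; so [e i * c] cannot lie
    in [P]. *)
Lemma sn_idem_prime P i c : is_prime P -> ~ P (e i) -> ~ P c -> GRing.comm (y i) c ->
  ~ P (e i * c).
Proof.
move=> Pp Pe Pc yc Pec; have [[P0 PD PM PM'] _ _] := Pp.
have [r] := is_prime_elt Pp Pe Pc; apply.
elim: (subalg_normal_form HA i (presents_Sn_gen HA r)) => {r}.
- by rewrite mulr0 mul0r.
- by move=> a b _ Ha _ Hb; rewrite mulrDr mulrDl; apply: PD.
- move=> [|k] l b Tb; last first.
    by rewrite exprS !mulrA (sn_idem_x HA) !mul0r.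
  rewrite expr0 mul1r mulrA (sn_idem_subalg HA _ Tb) ?inE ?eqxx // -!mulrA.
  by rewrite -(commrX l (commr_sym yc)) !mulrA -(mulrA b); apply/PM'/PM.
Qed.

Lemma sn_idems_prime P s c : is_prime P -> uniq s -> {in s, forall i, ~ P (e i)} ->
  (forall i, i \in s -> GRing.comm (y i) c) -> ~ P c -> ~ P (sn_idems x y s * c).
Proof.
move=> Pp; elim: s => [|i s IH] /=; first by rewrite /sn_idems big_nil mul1r.
move=> /andP[iNs us] Pe yc Pc; rewrite /sn_idems big_cons -/(sn_idems x y s) -mulrA.
apply: sn_idem_prime => //; first by apply: Pe; rewrite mem_head.
  apply: IH => // j js; first by apply: Pe; rewrite inE js orbT.
  by apply: yc; rewrite inE js orbT.
apply: commrM; last by apply: yc; rewrite mem_head.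
rewrite /sn_idems big_seq; apply: commr_prod => j js; apply: (sn_idem_comm_y HA).
by apply: contraNneq iNs => <-.
Qed.

Definition idem_support P : {set 'I_n} := [set i | `[< P (e i) >]].

Lemma idem_supportP P i : reflect (P (e i)) (i \in idem_support P).
Proof. by rewrite inE; apply: asboolP. Qed.

Fact sn_vars_comm J i j :
  GRing.comm (if i \in J then x i else 1) (if j \in J then x j else 1).
Proof.
case: ifP => _; last by apply/commr_sym/commr1.
by case: ifP => _; [apply: sn_xx_comm HA _ _|apply: commr1].
Qed.

Definition sn_eval J : R -> A := comm_eval (sn_vars_comm J).
HB.instance Definition _ J := GRing.RMorphism.on (sn_eval J).

Lemma sn_evalX J i : sn_eval J 'X_i = if i \in J then x i else 1.
Proof. exact: comm_evalX. Qed.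

Lemma sn_evalC J c : sn_eval J c%:MP = c%:A.
Proof. exact: comm_evalC. Qed.

(** Only a left inverse, from [y i * x i = 1]; it suffices to cancel monomials in front of an
    element of an ideal. *)
Lemma sn_monomial_inv J (m : 'X_{1..n}) : exists v, v * sn_eval J 'X_[m] = 1.
Proof.
rewrite (mpolyXE_id _ m) rmorph_prod.
apply: (big_ind (fun w => exists v, v * w = 1)) => [|a b [v va] [w wb]|i _].
- by exists 1; rewrite mul1r.
- by exists (w * v); rewrite mulrA -(mulrA w) va mulr1 wb.
- rewrite rmorphXn /= sn_evalX; case: ifP => [iS|_]; last by exists 1; rewrite expr1n mulr1.
  exists (y i ^+ m i); elim: (m i) => [|k IH]; first by rewrite mulr1.
  by rewrite exprSr exprS mulrA -(mulrA (y i ^+ k)) (sn_yx HA) mulr1.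
Qed.

Section ModIdeal.
Variables (I : A -> Prop) (J : {set 'I_n}).
Hypotheses (Iid : is_ideal I) (IJ : forall j, j \in J -> I (e j)).

Definition central_mod c := forall a, I (c * a - a * c).

Lemma central_mod_x j : j \in J -> central_mod (x j).
Proof.
case: Iid => I0 ID IM IM' jJ a; elim: (presents_Sn_gen HA a) => {a}.
- by move=> i _; rewrite (sn_xx_comm HA) subrr.
- move=> i _; have [->|ij] := eqVneq i j.
    rewrite (sn_yx HA) -opprB; apply: is_ideal_opp => //; exact: IJ.
  by rewrite (sn_xy_comm HA) ?subrr // eq_sym.
- by rewrite mulr1 mul1r subrr.
- move=> a b _ Ha _ Hb; rewrite mulrDr mulrDl opprD addrACA; exact: ID.
- move=> a b _ Ha _ Hb.
  rewrite (_ : _ - _ = (x j * a - a * x j) * b + a * (x j * b - b * x j)).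
    by apply: (ID); [apply: IM'|apply: IM].
  by rewrite mulrBl mulrBr !mulrA addrA subrK.
- by move=> k a _ Ha; rewrite -scalerAr -scalerAl -scalerBr -mulr_algl; apply: IM.
Qed.

Lemma central_modM c d : central_mod c -> central_mod d -> central_mod (c * d).
Proof.
case: Iid => I0 ID IM IM' Hc Hd a.
rewrite (_ : _ - _ = c * (d * a - a * d) + (c * a - a * c) * d).
  by apply: (ID); [apply: IM|apply: IM'].
by rewrite mulrBl mulrBr !mulrA addrA subrK.
Qed.

Lemma central_mod1 : central_mod 1.
Proof. by move=> a; rewrite mul1r mulr1 subrr; case: Iid. Qed.

Lemma sn_eval_central p : central_mod (sn_eval J p).
Proof.
case: (Iid) => I0 ID IM IM'; elim/mpoly_gen_ind: p => [c|i|p q Hp Hq|p q].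
- by rewrite sn_evalC => a; rewrite mulr_algl mulr_algr subrr.
- by rewrite sn_evalX; case: ifP => [/central_mod_x|_] //; apply: central_mod1.
- by move=> a; rewrite rmorphD mulrDr mulrDl opprD addrACA; apply: ID.
- by rewrite rmorphM; apply: central_modM.
Qed.

End ModIdeal.

(** The same [m] and [p] serve every ideal and every [pi]. Thus a condition on [pi b] and membership
    of [b] in a prime become conditions on one polynomial, which is how [tensor_prime_of] compares
    them. *)
Lemma sn_clear J b : subalg x y J b -> exists (m : 'X_{1..n}) p,
  (forall I, is_ideal I -> (forall j, j \in J -> I (e j)) ->
    I (sn_eval J 'X_[m] * b - sn_eval J p)) /\
  (forall (L : comAlgType K) (t u : 'I_n -> L) (pi : A -> L),
    (forall j, j \in J -> t j * u j = 1) -> is_pi x y J t u pi ->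
    laurent_eval J t 'X_[m] * pi b = laurent_eval J t p).
Proof.
elim=> {b}.
- move=> j jJ; exists 0%MM, 'X_j; split=> [I [I0 _ _ _] _|L t u pi tu [_ _ _ _ piE]]; last first.
    by rewrite mpolyX0 rmorph1 mul1r laurent_evalX jJ; case: (piE j jJ).
  by rewrite mpolyX0 rmorph1 mul1r /= sn_evalX jJ subrr.
- move=> j jJ; exists U_(j)%MM, 1; split=> [I Iid /(_ j jJ)|L t u pi tu [_ _ _ _ piE]]; last first.
    by rewrite rmorph1 laurent_evalX jJ; case: (piE j jJ) => _ ->; apply: tu.
  rewrite rmorph1 sn_evalX jJ => Ie; rewrite -opprB; exact: is_ideal_opp.
- exists 0%MM, 1; split=> [I [I0 _ _ _] _|L t u pi tu [_ _ pi1 _ _]]; last first.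
    by rewrite mpolyX0 rmorph1 mul1r.
  by rewrite mpolyX0 rmorph1 mul1r subrr.
- move=> a b Ta [m [p [E G]]] Tb [m' [p' [E' G']]].
  exists (m + m')%MM, ('X_[m'] * p + 'X_[m] * p'); split; last first.
    move=> L t u pi tu piP; have [piD _ _ _ _] := piP.
    by rewrite piD // mpolyXD rmorphD !rmorphM /= -(G _ _ _ _ tu piP) -(G' _ _ _ _ tu piP); ring.
  move=> I Iid IJ; have [_ ID IM _] := Iid.
  have -> : sn_eval J 'X_[m + m'] * (a + b) - sn_eval J ('X_[m'] * p + 'X_[m] * p') =
      sn_eval J 'X_[m'] * (sn_eval J 'X_[m] * a - sn_eval J p) +
      sn_eval J 'X_[m] * (sn_eval J 'X_[m'] * b - sn_eval J p').
    rewrite rmorphD !rmorphM /= !mulrBr addrACA -opprD mulrDr !mulrA -!rmorphM.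
    rewrite -!mpolyXD.
    by rewrite [(m' + m)%MM]addmC.
  by apply: (ID); apply: IM; [apply: E|apply: E'].
- move=> a b Ta [m [p [E G]]] Tb [m' [p' [E' G']]]; exists (m + m')%MM, (p * p'); split; last first.
    move=> L t u pi tu piP; have [_ piM _ _ _] := piP.
    by rewrite piM // mpolyXD !rmorphM /= -(G _ _ _ _ tu piP) -(G' _ _ _ _ tu piP); ring.
  move=> I Iid IJ; have [_ ID IM IM'] := Iid.
  (* The first summand moves ['X_[m']] past [a]; it lies in [I] because the evaluated polynomials
     are central modulo [I]. *)
  have -> : sn_eval J 'X_[m + m'] * (a * b) - sn_eval J (p * p') =
      sn_eval J 'X_[m] * (sn_eval J 'X_[m'] * a - a * sn_eval J 'X_[m']) * b +
      ((sn_eval J 'X_[m] * a - sn_eval J p) * (sn_eval J 'X_[m'] * b) +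
      sn_eval J p * (sn_eval J 'X_[m'] * b - sn_eval J p')).
    by rewrite mpolyXD !rmorphM /= !mulrBr !mulrBl !mulrA !subrKA.
  apply: (ID); first by apply: (IM'); apply: (IM); apply: sn_eval_central.
  by apply: (ID); [apply: (IM'); apply: E|apply: (IM); apply: E'].
- move=> k a Ta [m [p [E G]]]; exists m, (k%:MP * p); split; last first.
    move=> L t u pi tu piP; have [_ _ _ piZ _] := piP.
    by rewrite piZ // rmorphM /= laurent_evalC -(G _ _ _ _ tu piP) mulr_algl scalerAr.
  move=> I Iid IJ.
  rewrite rmorphM /= sn_evalC mulr_algl -scalerAr -scalerBr -mulr_algl.
  by case: (Iid) => _ _ IM _; apply: (IM); apply: E.
Qed.

Definition sn_contract P : R -> Prop := fun p => P (sn_eval (idem_support P) p).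

Lemma sn_contract_torus P : is_prime P -> torus_prime (idem_support P) (sn_contract P).
Proof.
move=> Pp; have [Pi P1 _] := Pp; have [P0 PD PM PM'] := Pi.
split; first split; first split.
- by rewrite /sn_contract rmorph0.
- by move=> a b Ha Hb; rewrite /sn_contract rmorphD; apply: PD.
- by move=> a b Hb; rewrite /sn_contract rmorphM; apply: PM.
- by move=> a b Hb; rewrite /sn_contract rmorphM; apply: PM'.
- by rewrite /sn_contract rmorph1.
- move=> a b; rewrite /sn_contract rmorphM /= => Pab; apply: contrapT => /not_orP[Pa Pb].
  have [r] := is_prime_elt Pp Pa Pb; apply.
  set f := sn_eval _ a in Pab *; set g := sn_eval _ b in Pab *.
  rewrite -(subrK (r * f) (f * r)) mulrDl; apply: (PD); last by rewrite -mulrA; apply: PM.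
  by apply: PM'; apply: sn_eval_central => // j /idem_supportP.
- move=> i Qi; have [v vX] := sn_monomial_inv (idem_support P) U_(i); apply: P1.
  by rewrite -vX; apply: PM.
- by move=> i iJ; rewrite /sn_contract rmorphB rmorph1 /= sn_evalX (negbTE iJ) subrr.
Qed.

(* Two-sided multiplication moves [a] into the corner cut out by the idempotents not in [P], where
   it becomes a polynomial up to a unit modulo [P]. *)
Lemma sn_prime_le P P' : is_prime P -> is_prime P' -> idem_support P = idem_support P' ->
  (forall p, sn_contract P p -> sn_contract P' p) -> forall a, P a -> P' a.
Proof.
move=> Pp P'p JE sub a Pa; apply: contrapT => P'a.
have [Pi _ _] := Pp; have [P'i P'1 _] := P'p.
have [P0 PD PM PM'] := Pi; have [P'0 P'D P'M P'M'] := P'i.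
set J := idem_support P in JE.
pose s := enum (~: J); have us : uniq s by apply: enum_uniq.
have sJ i : i \in s -> i \notin J by rewrite mem_enum in_setC.
have sP i : i \in s -> ~ P (e i) by move=> /sJ iJ /idem_supportP; apply/negP.
have sP' i : i \in s -> ~ P' (e i).
  by move=> /sJ iJ /idem_supportP; rewrite -JE; apply/negP.
set E := sn_idems x y s.
have P'E : ~ P' E.
  by rewrite -[E]mulr1; apply: sn_idems_prime => // i _; apply: commr1.
(* The element [E * r * a * r' * E] lies in [P] but not in [P'], and it equals [E * b] with [b] in
   the algebra of [J]. As [E] can be cancelled modulo [P], also [b] lies in [P] but not in [P']. *)
have [r P'r] := is_prime_elt P'p P'E P'a; have [r' P'r'] := is_prime_elt P'p P'r P'E.
have [b Tb bE] := sn_corners HA s (presents_Sn_gen HA (r * a * r')).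
have Jb : subalg x y J b.
  by apply: subalg_sub Tb; apply/subsetP => i; rewrite in_setD in_set mem_enum in_setC negbK => /andP[].
have yb i : i \in s -> GRing.comm (y i) b.
  move=> /sJ iJ; apply: subalg_comm Jb => j jJ.
    by apply/esym/(sn_xy_comm HA); apply: contraNneq iJ => <-.
  exact: sn_yy_comm HA _ _.
have Pb : P b.
  apply: contrapT => /(sn_idems_prime Pp us sP yb); apply; rewrite -bE.
  by apply: (PM'); apply: (PM); apply: (PM'); apply: (PM).
have P'b : ~ P' b.
  move=> P'b; apply: P'r'; rewrite (_ : _ * E = E * b); first exact: P'M.
  by rewrite /E -bE !mulrA.
have [m [p [mp _]]] := sn_clear Jb; apply: P'b.
have [v vX] := sn_monomial_inv J m; rewrite -[b]mul1r -vX -mulrA; apply: P'M.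
rewrite -(subrK (sn_eval J p) (_ * b)); apply: (P'D).
  by apply: mp => // j; rewrite JE => /idem_supportP.
rewrite JE; apply: sub; rewrite /sn_contract -/J.
rewrite -(subKr (sn_eval J 'X_[m] * b) (sn_eval J p)); apply: (PD); first exact: PM.
by apply: is_ideal_opp => //; apply: mp => // j /idem_supportP.
Qed.

Lemma sn_prime_eq P P' : is_prime P -> is_prime P' -> idem_support P = idem_support P' ->
  sn_contract P = sn_contract P' -> P = P'.
Proof.
move=> Pp P'p JE QE; apply: same_ideal_eq => a; split; apply: sn_prime_le => //.
  by rewrite QE.
by rewrite QE.
Qed.

Definition sn_rank P := (2 * #|~: idem_support P| + trdeg (sn_contract P))%N.

(** With equal supports the contractions grow strictly and [trdeg_lt] applies. Otherwise an
    independent set for [P'], cut down to the support of [P], stays independent for [P]; the loss is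
    at most the number of new indices, and each of these counts twice in the rank. *)
Lemma sn_rank_lt P P' : is_prime P -> is_prime P' -> strict_sub P P' ->
  (sn_rank P' < sn_rank P)%N.
Proof.
move=> Pp P'p [sub [a [P'a Pa]]].
have tQ := sn_contract_torus Pp; have tQ' := sn_contract_torus P'p.
have [[Q'i Q'1 _] _ _] := tQ'; have [Qp _ _] := tQ.
have sJ : idem_support P \subset idem_support P'.
  by apply/subsetP => i /idem_supportP/sub/idem_supportP.
have [JE|JN] := eqVneq (idem_support P) (idem_support P').
  rewrite /sn_rank JE ltn_add2l.
  have QQ' p : sn_contract P p -> sn_contract P' p.
    by rewrite /sn_contract -JE; apply: sub.
  have [p Q'p Qp'] : exists2 p, sn_contract P' p & ~ sn_contract P p.
    apply: contrapT => nex; apply: Pa; move: a P'a; apply: sn_prime_le => // p Q'p.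
    by apply: contrapT => Qp'; apply: nex; exists p.
  exact: trdeg_lt Q'p Qp'.
have [J1 iJ1 J1d] := trdegP Q'i Q'1; set J := idem_support P in sJ JN *.
set J' := idem_support P' in sJ JN *.
have iJ : indep (sn_contract P) (J1 :&: J).
  move=> p /sub Hp; rewrite -(proj_vars_sub p (subsetIl J1 J)); apply: iJ1.
  rewrite proj_vars_sub ?subsetIl // /sn_contract -/J'.
  rewrite (_ : sn_eval J' _ = sn_eval J (proj_vars (J1 :&: J) p)) //.
  apply: (mpoly_morph_ext (f := sn_eval J' \o proj_vars (J1 :&: J))
    (g := sn_eval J \o proj_vars (J1 :&: J))) => [c|k] /=.
    by rewrite proj_varsC !sn_evalC.
  rewrite proj_varsX; case: ifP => [|_]; last by rewrite !rmorph0.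
  by rewrite inE => /andP[_ kJ]; rewrite !sn_evalX kJ (subsetP sJ).
have sJ1 : J1 \subset J' by apply: torus_indep_sub iJ1.
have d1 : (trdeg (sn_contract P') <= trdeg (sn_contract P) + #|J' :\: J|)%N.
  rewrite -J1d -(cardsID J J1) leq_add ?indep_trdeg //.
  by apply/subset_leq_card/setSD.
have c1 := card_setC_sub sJ.
have c2 : (0 < #|J' :\: J|)%N.
  rewrite card_gt0; apply: contraNneq JN => /eqP; rewrite setD_eq0 => s'.
  by rewrite eqEsubset sJ.
rewrite /sn_rank -/J -/J' c1 mulnDr -addnA ltn_add2l.
apply: leq_ltn_trans d1 _; rewrite addnC ltn_add2r.
by rewrite -[ltnLHS]mul1n ltn_pmul2r.
Qed.

Lemma sn_rank_le P : is_prime P -> (sn_rank P <= 2 * n)%N.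
Proof.
move=> /sn_contract_torus/torus_trdeg le; rewrite /sn_rank.
rewrite -[X in (_ <= 2 * X)%N]card_ord -(cardsC (idem_support P)) mulnDr addnC leq_add2r.
by apply: leq_trans le _; rewrite leq_pmull.
Qed.
End JacobsonPrimes.

(** * Representations by shifts and scalars *)

Section LinearOperators.
Variables (K F : fieldType) (iota : {rmorphism K -> F}) (T : Type) (t0 : T).
Local Notation V := (T -> F).

Definition lin_op_axiom (a : V -> V) := forall c f g s,
  a (fun r => c * f r + g r) s = c * a f s + a g s.

Record lin_op := LinOp { lin_op_fun :> V -> V; lin_opP : lin_op_axiom lin_op_fun }.
(** The type remembers [iota] for the scalars from [K], and the point [t0], at which 1 differs from
    0. *)
Definition lin_alg : Type := let _ := (iota, t0) in lin_op.
HB.instance Definition _ := gen_eqMixin lin_alg.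
HB.instance Definition _ := gen_choiceMixin lin_alg.
Implicit Types a b d : lin_alg.

Lemma lin_alg_eq a b : (forall f s, (a : lin_op) f s = (b : lin_op) f s) -> a = b.
Proof.
case: a b => [a aP] [b bP] /= ab.
have E : a = b by apply/funext => f; apply/funext => s; apply: ab.
by case: _ / E bP => bP; congr LinOp; apply: Prop_irrelevance.
Qed.

Fact lin_zero_proof : lin_op_axiom (fun _ _ => 0).
Proof. by move=> c f g s; rewrite mulr0 addr0. Qed.
Fact lin_one_proof : lin_op_axiom id. Proof. by []. Qed.
Fact lin_opp_proof (a : lin_op) : lin_op_axiom (fun f s => - a f s).
Proof. by move=> c f g s; rewrite lin_opP opprD mulrN. Qed.
Fact lin_add_proof (a b : lin_op) : lin_op_axiom (fun f s => a f s + b f s).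
Proof. by move=> c f g s; rewrite !lin_opP mulrDr addrACA. Qed.
Fact lin_mul_proof (a b : lin_op) : lin_op_axiom (fun f => a (b f)).
Proof.
move=> c f g s; rewrite -lin_opP; congr (lin_op_fun a _ s).
by apply/funext => r; apply: lin_opP.
Qed.
Fact lin_scale_proof (k : F) (a : lin_op) : lin_op_axiom (fun f s => k * a f s).
Proof. by move=> c f g s; rewrite lin_opP mulrDr mulrCA. Qed.

Definition lin_zero : lin_alg := LinOp lin_zero_proof.
Definition lin_one : lin_alg := LinOp lin_one_proof.
Definition lin_opp a : lin_alg := LinOp (lin_opp_proof a).
Definition lin_add a b : lin_alg := LinOp (lin_add_proof a b).
Definition lin_mul a b : lin_alg := LinOp (lin_mul_proof a b).
Definition lin_scale k a : lin_alg := LinOp (lin_scale_proof k a).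

Fact lin_addA : associative lin_add.
Proof. by move=> a b d; apply: lin_alg_eq => f s; apply: addrA. Qed.
Fact lin_addC : commutative lin_add.
Proof. by move=> a b; apply: lin_alg_eq => f s; apply: addrC. Qed.
Fact lin_add0 : left_id lin_zero lin_add.
Proof. by move=> a; apply: lin_alg_eq => f s; apply: add0r. Qed.
Fact lin_addN : left_inverse lin_zero lin_opp lin_add.
Proof. by move=> a; apply: lin_alg_eq => f s; apply: addNr. Qed.
HB.instance Definition _ := GRing.isZmodule.Build lin_alg lin_addA lin_addC lin_add0 lin_addN.

Fact lin_mulA : associative lin_mul.
Proof. by move=> a b d; apply: lin_alg_eq. Qed.
Fact lin_mul1 : left_id lin_one lin_mul.
Proof. by move=> a; apply: lin_alg_eq. Qed.
Fact lin_mulr1 : right_id lin_one lin_mul.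
Proof. by move=> a; apply: lin_alg_eq. Qed.
Fact lin_mulDl : left_distributive lin_mul lin_add.
Proof. by move=> a b d; apply: lin_alg_eq. Qed.

Lemma lin_opD (a : lin_op) f g s : a (fun r => f r + g r) s = a f s + a g s.
Proof.
rewrite -[a f s]mul1r -lin_opP; congr (lin_op_fun a _ s).
by apply/funext => r; rewrite mul1r.
Qed.

Lemma lin_op0 (a : lin_op) s : a (fun=> 0) s = 0.
Proof.
apply: (addIr (a (fun=> 0) s)); rewrite add0r -lin_opD; congr (lin_op_fun a _ s).
by apply/funext => r; rewrite addr0.
Qed.

Lemma lin_opZ (a : lin_op) c f s : a (fun r => c * f r) s = c * a f s.
Proof.
rewrite -[RHS]addr0 -(lin_op0 a s) -lin_opP; congr (lin_op_fun a _ s).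
by apply/funext => r; rewrite addr0.
Qed.

Fact lin_mulDr : right_distributive lin_mul lin_add.
Proof. by move=> a b d; apply: lin_alg_eq => f s; apply: lin_opD. Qed.
Fact lin_one_neq0 : lin_one != lin_zero.
Proof.
apply/eqP => /(congr1 (fun a : lin_alg => (a : lin_op) (fun=> 1) t0))/eqP.
by rewrite oner_eq0.
Qed.
HB.instance Definition _ := GRing.Zmodule_isNzRing.Build lin_alg
  lin_mulA lin_mul1 lin_mulr1 lin_mulDl lin_mulDr lin_one_neq0.

Lemma lin_mulE a b f s : (a * b : lin_alg) f s = (a : lin_op) ((b : lin_op) f) s.
Proof. by []. Qed.

Definition lin_scal (c : F) : lin_alg := lin_scale c lin_one.
Fact lin_scal_additive : zmod_morphism lin_scal.
Proof. by move=> c d; apply: lin_alg_eq => f s; apply: mulrBl. Qed.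
Fact lin_scal_multiplicative : monoid_morphism lin_scal.
Proof.
by split=> [|c d]; apply: lin_alg_eq => f s; [apply: mul1r|apply/esym/mulrA].
Qed.
HB.instance Definition _ := GRing.isZmodMorphism.Build F lin_alg lin_scal lin_scal_additive.
HB.instance Definition _ := GRing.isMonoidMorphism.Build F lin_alg lin_scal lin_scal_multiplicative.

Definition lin_kscale (k : K) a : lin_alg := lin_scale (iota k) a.
Fact lin_kscaleA k l a : lin_kscale k (lin_kscale l a) = lin_kscale (k * l) a.
Proof. by apply: lin_alg_eq => f s; rewrite /= rmorphM mulrA. Qed.
Fact lin_kscale1 : left_id 1 lin_kscale.
Proof. by move=> a; apply: lin_alg_eq => f s; rewrite /= rmorph1 mul1r. Qed.
Fact lin_kscaleDr : right_distributive lin_kscale +%R.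
Proof. by move=> k a b; apply: lin_alg_eq => f s; apply: mulrDr. Qed.
Fact lin_kscaleDl a : {morph lin_kscale^~ a : k l / k + l}.
Proof. by move=> k l; apply: lin_alg_eq => f s; rewrite /= rmorphD mulrDl. Qed.
HB.instance Definition _ := GRing.Zmodule_isLmodule.Build K lin_alg
  lin_kscaleA lin_kscale1 lin_kscaleDr lin_kscaleDl.
Fact lin_kscaleAl (k : K) a b : k *: (a * b) = (k *: a) * b.
Proof. exact: lin_alg_eq. Qed.
HB.instance Definition _ := GRing.Lmodule_isLalgebra.Build K lin_alg lin_kscaleAl.
Fact lin_kscaleAr (k : K) a b : k *: (a * b) = a * (k *: b).
Proof. by apply: lin_alg_eq => f s; apply/esym/lin_opZ. Qed.
HB.instance Definition _ := GRing.Lalgebra_isAlgebra.Build K lin_alg lin_kscaleAr.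
End LinearOperators.

Section Shifts.
Variables (K : fieldType) (n : nat) (F : fieldType) (iota : {rmorphism K -> F}).
Local Notation idx := {ffun 'I_n -> nat}.
Local Notation V := (idx -> F).
Local Notation B := (lin_alg iota ([ffun=> 0%N] : idx)).
Implicit Types (alpha beta : idx) (f g : V) (J : {set 'I_n}).

Definition set_coord i (k : nat -> nat) alpha : idx :=
  [ffun j => if j == i then k (alpha j) else alpha j].

Fact shift_op_proof i (v : nat -> F) k :
  lin_op_axiom (fun f alpha => v (alpha i) * f (set_coord i k alpha)).
Proof. by move=> c f g s; rewrite mulrDr mulrCA. Qed.
Definition shift_op i v k : B := LinOp (shift_op_proof i v k).

Lemma set_coordC i j k l alpha : i != j ->
  set_coord i k (set_coord j l alpha) = set_coord j l (set_coord i k alpha).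
Proof.
move=> ij; apply/ffunP => m; rewrite !ffunE.
by case: (eqVneq m i) => [->|//]; rewrite (negbTE ij).
Qed.

Lemma set_coordK i k l alpha : set_coord i k (set_coord i l alpha) = set_coord i (k \o l) alpha.
Proof. by apply/ffunP => m; rewrite !ffunE; case: eqP. Qed.

Lemma set_coord_id i k alpha : k (alpha i) = alpha i -> set_coord i k alpha = alpha.
Proof. by move=> E; apply/ffunP => m; rewrite !ffunE; case: eqP => [->|]. Qed.

Lemma set_coord_at i k alpha : set_coord i k alpha i = k (alpha i).
Proof. by rewrite ffunE eqxx. Qed.

Lemma set_coord_other i j k alpha : j != i -> set_coord i k alpha j = alpha j.
Proof. by rewrite ffunE => /negbTE->. Qed.

Lemma shift_opC i j v w k l : i != j ->
  shift_op i v k * shift_op j w l = shift_op j w l * shift_op i v k.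
Proof.
move=> ij; apply: lin_alg_eq => f alpha; rewrite !lin_mulE /=.
have ji : j != i by rewrite eq_sym.
by rewrite !set_coord_other // set_coordC // mulrCA.
Qed.

Variable z : 'I_n -> F.
Hypothesis z0 : forall i, z i != 0.

Section Support.
Variable J : {set 'I_n}.

(** As [predn] fixes 0, the vanishing at the boundary must come from the weight; it is what makes
    [x i] a one-sided inverse only. *)
Definition shift_x i : B :=
  if i \in J then shift_op i (fun=> z i) id else shift_op i (fun k => (k != 0%N)%:R) predn.
Definition shift_y i : B :=
  if i \in J then shift_op i (fun=> (z i)^-1) id else shift_op i (fun=> 1) succn.

Lemma shift_rels : jacobson_rels shift_x shift_y.
Proof.
split=> [i|i j ij].
  rewrite /shift_x /shift_y; case: ifP => _; apply: lin_alg_eq => f alpha; rewrite lin_mulE /=.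
    by rewrite mulrA mulVf // mul1r set_coordK set_coord_id.
  by rewrite set_coord_at !mul1r set_coordK set_coord_id.
by rewrite /shift_x /shift_y; case: (i \in J); case: (j \in J); split; apply: shift_opC.
Qed.

Variables (A : algType K) (x y : 'I_n -> A) (rho : A -> B).
Hypothesis HA : presents_Sn x y.
Hypothesis rho_hom : is_alg_hom rho.
Hypothesis rhoxy : forall i, rho (x i) = shift_x i /\ rho (y i) = shift_y i.
Local Notation act a := (lin_op_fun (rho a : lin_op F idx)).

Definition agree alpha beta := forall i, i \notin J -> alpha i = beta i.
(** Functions of fewer coordinates are kept inside the functions on N^n, so that representations
    with different supports act on a common space. *)
Definition indep_of f := forall alpha beta, agree alpha beta -> f alpha = f beta.

Lemma act1 f : act 1 f = f. Proof. by case: rho_hom => _ _ -> _. Qed.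
Lemma actD a b f alpha : act (a + b) f alpha = act a f alpha + act b f alpha.
Proof. by case: rho_hom => -> _ _ _. Qed.
Lemma actM a b f : act (a * b) f = act a (act b f).
Proof. by case: rho_hom => _ -> _ _. Qed.
Lemma actZ k a f alpha : act (k *: a) f alpha = iota k * act a f alpha.
Proof. by case: rho_hom => _ _ _ ->. Qed.
Lemma act_x i f alpha : act (x i) f alpha =
  if i \in J then z i * f alpha else (alpha i != 0%N)%:R * f (set_coord i predn alpha).
Proof.
case: (rhoxy i) => -> _; rewrite /shift_x; case: ifP => _ //=.
by rewrite set_coord_id.
Qed.
Lemma act_y i f alpha : act (y i) f alpha =
  if i \in J then (z i)^-1 * f alpha else f (set_coord i succn alpha).
Proof.
case: (rhoxy i) => _ ->; rewrite /shift_y; case: ifP => _ //=.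
  by rewrite set_coord_id.
by rewrite mul1r.
Qed.

Lemma act0 a alpha : act a (fun=> 0) alpha = 0.
Proof. exact: lin_op0. Qed.

Lemma agree_set i k alpha beta : i \notin J -> agree alpha beta ->
  agree (set_coord i k alpha) (set_coord i k beta).
Proof. by move=> iJ ab j jJ; rewrite !ffunE ab. Qed.

Lemma act_indep_of a f : indep_of f -> indep_of (act a f).
Proof.
elim: (presents_Sn_gen HA a) f => {a}.
- move=> i _ f fJ alpha beta ab; rewrite !act_x; case: ifPn => iJ; first by rewrite (fJ _ _ ab).
  by rewrite (ab i iJ) (fJ _ (set_coord i predn beta)) //; apply: agree_set.
- move=> i _ f fJ alpha beta ab; rewrite !act_y; case: ifPn => iJ; first by rewrite (fJ _ _ ab).
  by apply/fJ/agree_set.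
- by move=> f fJ; rewrite act1.
- by move=> a b _ Ha _ Hb f fJ alpha beta ab; rewrite !actD (Ha f fJ _ _ ab) (Hb f fJ _ _ ab).
- by move=> a b _ Ha _ Hb f fJ; rewrite actM; apply/Ha/Hb.
- by move=> k a _ Ha f fJ alpha beta ab; rewrite !actZ (Ha f fJ _ _ ab).
Qed.

(** Functions of infinite support are not combinations of the [delta_fun]; this locality supplies
    the finiteness needed in [act_delta]. *)
Lemma act_local a : exists s : idx -> seq idx, forall f alpha,
  {in s alpha, forall beta, f beta = 0} -> act a f alpha = 0.
Proof.
elim: (presents_Sn_gen HA a) => {a}.
- move=> i _; exists (fun alpha => [:: alpha; set_coord i predn alpha]) => f alpha Hf.
  by rewrite act_x; case: ifP => _; rewrite Hf ?mulr0 // !inE eqxx ?orbT.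
- move=> i _; exists (fun alpha => [:: alpha; set_coord i succn alpha]) => f alpha Hf.
  by rewrite act_y; case: ifP => _; rewrite Hf ?mulr0 // !inE eqxx ?orbT.
- exists (fun alpha => [:: alpha]) => f alpha Hf.
  by rewrite act1 Hf ?mem_head.
- move=> a b _ [s Hs] _ [s' Hs']; exists (fun alpha => s alpha ++ s' alpha) => f alpha Hf.
  rewrite actD Hs ?Hs' ?addr0 // => beta sb; apply: Hf; rewrite mem_cat sb ?orbT //.
- move=> a b _ [s Hs] _ [s' Hs'].
  exists (fun alpha => flatten [seq s' beta | beta <- s alpha]) => f alpha Hf.
  rewrite actM; apply: Hs => beta sb; apply: Hs' => gamma sg; apply: Hf.
  by apply/flatten_mapP; exists beta.
- by move=> k a _ [s Hs]; exists s => f alpha Hf; rewrite actZ Hs ?mulr0.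
Qed.

Definition agreeb alpha beta := [forall i, (i \in J) || (alpha i == beta i)].
Lemma agreeP alpha beta : reflect (agree alpha beta) (agreeb alpha beta).
Proof.
apply: (iffP forallP) => H i; first by move/negbTE=> iJ; have := H i; rewrite iJ => /eqP.
by case: (boolP (i \in J)) => //= iJ; apply/eqP/H.
Qed.

Definition delta_fun beta : V := fun alpha => (agreeb alpha beta)%:R.

Lemma delta_indep_of beta : indep_of (delta_fun beta).
Proof.
move=> alpha alpha' aa'; rewrite /delta_fun; congr (_ %:R); congr nat_of_bool.
by apply/agreeP/agreeP => H i iJ; [rewrite -aa' //|rewrite aa' //]; apply: H.
Qed.

(** If [a] sent every [delta_fun] to a function vanishing at [alpha], then subtracting multiples of
    them would make [f] zero at the finitely many points that matter, without changing the value at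
    [alpha]. *)
Lemma act_delta a f alpha : indep_of f -> act a f alpha != 0 ->
  exists beta, act a (delta_fun beta) alpha != 0.
Proof.
move=> fJ nz; apply: contrapT => nex.
have z0' beta : act a (delta_fun beta) alpha = 0.
  by apply/eqP; apply: contrapT => /negP nb; apply: nex; exists beta.
have [s Hs] := act_local a.
have [g [gJ g0 gE]] : exists g, [/\ indep_of g, {in s alpha, forall beta, g beta = 0} &
    act a g alpha = act a f alpha].
  elim: (s alpha) => [|beta l [g [gJ g0 gE]]]; first by exists f.
  exists (fun gamma => - g beta * delta_fun beta gamma + g gamma); split.
  - by move=> gamma gamma' H; rewrite (gJ _ _ H) (delta_indep_of _ H).
  - move=> gamma; rewrite inE => /orP[/eqP->|gl].
      by rewrite /delta_fun (introT (agreeP _ _)) // mulr1 addNr.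
    rewrite (g0 _ gl) addr0 /delta_fun; case: agreeP => [H|_]; last by rewrite mulr0.
    by rewrite -(gJ _ _ H) (g0 _ gl) oppr0 mul0r.
  - by rewrite lin_opP z0' mulr0 add0r.
by move: nz; rewrite -gE (Hs _ _ g0) eqxx.
Qed.

Lemma act_yX i m f alpha : i \notin J ->
  act (y i ^+ m) f alpha = f (set_coord i (addn m) alpha).
Proof.
move=> iJ; elim: m f alpha => [|m IH] f alpha; first by rewrite expr0 act1 set_coord_id.
rewrite exprS actM act_y (negbTE iJ) IH set_coordK; congr (f _).
by apply/ffunP => j; rewrite !ffunE; case: eqP => // _ /=; rewrite addnS.
Qed.

Lemma act_xX i m f alpha : i \notin J ->
  act (x i ^+ m) f alpha = (m <= alpha i)%:R * f (set_coord i (subn^~ m) alpha).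
Proof.
move=> iJ; elim: m f alpha => [|m IH] f alpha.
  by rewrite expr0 act1 set_coord_id ?subn0 // mul1r.
rewrite exprS actM act_x (negbTE iJ) IH set_coordK set_coord_at mulrA -natrM mulnb.
congr (_ %:R * f _); first by congr nat_of_bool; case: (alpha i) => //= k; rewrite ltnS.
by apply/ffunP => j; rewrite !ffunE; case: eqP => // _ /=; rewrite subnS -!subn1 subnAC.
Qed.

Lemma act_idem i f alpha : i \notin J -> act (sn_idem x y i) f alpha = (alpha i == 0%N)%:R * f alpha.
Proof.
move=> iJ; rewrite /sn_idem -scaleN1r actD act1 actZ actM act_x (negbTE iJ) act_y (negbTE iJ).
rewrite rmorphN1 mulN1r; case: eqP => [|/eqP nz] /=; first by rewrite mul0r subr0 mul1r.
rewrite mul1r mul0r set_coordK set_coord_id ?subrr //=.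
by rewrite prednK // lt0n.
Qed.

Lemma act_unit i k m : i \notin J -> exists a, forall f alpha,
  act a f alpha = (alpha i == k)%:R * f (set_coord i (fun=> m) alpha).
Proof.
move=> iJ; exists (x i ^+ k * sn_idem x y i * y i ^+ m) => f alpha.
rewrite !actM act_xX // act_idem // act_yX // mulrA -natrM mulnb set_coord_at.
rewrite subn_eq0 -eqn_leq eq_sym set_coordK; case: eqP => [E|_]; last by rewrite !mul0r.
congr (_ * f _).
by apply/ffunP => j; rewrite !ffunE; case: eqP => // -> /=; rewrite -E subnn addn0.
Qed.

Lemma act_matrix_unit beta gamma : exists a, forall f, indep_of f -> forall alpha,
  act a f alpha = f gamma * delta_fun beta alpha.
Proof.
have [a Ha] : exists a, forall f alpha, act a f alpha =
    (all (fun i => alpha i == beta i) (enum (~: J)))%:R *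
    f [ffun j => if j \in enum (~: J) then gamma j else alpha j].
  have : {in enum (~: J), forall i, i \notin J} by move=> i; rewrite mem_enum inE.
  have := enum_uniq (~: J).
  elim: (enum (~: J)) => [_ _|i s IH /= /andP[iNs us] sJ].
    exists 1 => f alpha; rewrite act1 mul1r; congr (f _).
    by apply/ffunP => j; rewrite ffunE.
  have [|a Ha] := IH us; first by move=> j js; apply: sJ; rewrite inE js orbT.
  have [b Hb] := act_unit (beta i) (gamma i) (sJ i (mem_head _ _)).
  exists (b * a) => f alpha; rewrite actM Hb Ha mulrA -natrM mulnb; congr (_ %:R * f _).
    congr nat_of_bool; congr (_ && _); apply: eq_in_all => j js; rewrite set_coord_other //.
    by apply: contraNneq iNs => <-.
  apply/ffunP => j; rewrite !ffunE inE; case: eqP => [->|_] //=.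
  by rewrite (negbTE iNs).
exists a => f fJ alpha; rewrite Ha mulrC; congr (_ * _%:R).
  by apply: fJ => i iJ; rewrite ffunE mem_enum inE iJ.
congr nat_of_bool; apply/allP/agreeP => [H i iJ|H i].
  by apply/eqP/H; rewrite mem_enum inE.
by rewrite mem_enum inE => iJ; apply/eqP/H.
Qed.

(* The generators [x_j], [y_j] with [j] in [J] act by scalars; functions independent of these
   coordinates are functions on [N^(n - |J|)]. *)
Definition act_kernel a := forall f, indep_of f -> forall alpha, act a f alpha = 0.

(** If [a] does not kill some [delta_fun beta] at [alpha] and [b] does not kill [g] at [gamma], a
    matrix unit [E] carries the value at [gamma] to [delta_fun beta], and [a * (E * b)] sends [g] to
    a function with a nonzero product as value at [alpha]. *)
Lemma act_kernel_prime : is_prime act_kernel.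
Proof.
split.
- split.
  + by move=> f _ alpha; rewrite -(scale0r 1) actZ rmorph0 mul0r.
  + by move=> a b Ha Hb f fJ alpha; rewrite actD Ha // Hb // addr0.
  + move=> r a Ha f fJ alpha; rewrite actM -(act0 r alpha); congr (act r _ alpha).
    by apply/funext => beta; apply: Ha.
  + by move=> r a Ha f fJ alpha; rewrite actM; apply/Ha/act_indep_of.
- move=> /(_ (fun=> 1) (fun _ _ _ => erefl) [ffun=> 0%N])/eqP.
  by rewrite act1 oner_eq0.
- move=> I I' Iid I'id II'.
  have [|/existsNP[a /not_implyP[Ia /existsNP[f /not_implyP[fJ /existsNP[alpha nz]]]]]] :=
    pselect (forall a, I a -> act_kernel a); first by left.
  right=> b Ib g gJ gamma; apply: contrapT => nz'.
  have [beta nzd] := act_delta fJ (introN eqP nz).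
  have [E HE] := act_matrix_unit beta gamma.
  have /(_ g gJ alpha)/eqP : act_kernel (a * (E * b)).
    by apply: II' => //; case: I'id => _ _ IM _; apply: IM.
  rewrite !actM; set h := act b g; have hJ : indep_of h by apply: act_indep_of.
  have -> : act E h = fun al => h gamma * delta_fun beta al by apply/funext => al; apply: HE.
  by rewrite lin_opZ mulf_eq0 (negbTE nzd) orbF => /eqP.
Qed.

Lemma act_kernel_support : idem_support x y act_kernel = J.
Proof.
apply/setP => i; apply/idem_supportP/idP => [H|iJ f fJ alpha].
  apply: contraT => iJ; have /eqP := H (fun=> 1) (fun _ _ _ => erefl) [ffun=> 0%N].
  by rewrite act_idem // ffunE eqxx mul1r oner_eq0.
rewrite /sn_idem -scaleN1r actD act1 actZ actM act_x act_y iJ rmorphN1 mulN1r.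
by rewrite mulrA divff // mul1r subrr.
Qed.

Lemma act_kernel_contract (phi : {rmorphism {mpoly K[n]} -> F}) :
  (forall c, phi c%:MP = iota c) -> (forall i, phi 'X_i = if i \in J then z i else 1) ->
  forall p, sn_contract HA act_kernel p <-> phi p = 0.
Proof.
move=> phiC phiX p; rewrite /sn_contract act_kernel_support.
have E : rho (sn_eval HA J p) = lin_scal iota _ (phi p).
  apply: (mpoly_morph_ext (f := alg_hom_fun rho_hom \o sn_eval HA J)
    (g := lin_scal iota [ffun=> 0%N] \o phi)) => [c|i] /=.
    rewrite /alg_hom_fun sn_evalC phiC; apply: lin_alg_eq => f alpha.
    by rewrite actZ act1.
  rewrite /alg_hom_fun sn_evalX phiX; apply: lin_alg_eq => f alpha.
  by case: ifP => iJ; rewrite ?act_x ?iJ ?act1 //= mul1r.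
rewrite /act_kernel E; split=> [/(_ (fun=> 1) (fun _ _ _ => erefl) [ffun=> 0%N])|E0 f _ alpha] /=.
  by rewrite mulr1.
by rewrite E0 mul0r.
Qed.
End Support.
End Shifts.

Section KernelInclusion.
Variables (K : fieldType) (n : nat) (F : fieldType) (iota : {rmorphism K -> F}).
Local Notation idx := {ffun 'I_n -> nat}.
Local Notation B := (lin_alg iota ([ffun=> 0%N] : idx)).
Variables (z : 'I_n -> F) (z0 : forall i, z i != 0) (J : {set 'I_n}) (i : 'I_n).
Hypothesis iJ : i \notin J.
Variables (A : algType K) (x y : 'I_n -> A) (rho rho' : A -> B).
Hypotheses (HA : presents_Sn x y) (rho_hom : is_alg_hom rho) (rho'_hom : is_alg_hom rho').
Hypothesis rhoxy : forall j, rho (x j) = shift_x iota z J j /\ rho (y j) = shift_y iota z J j.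
Hypothesis rho'xy : forall j, rho' (x j) = shift_x iota z (i |: J) j /\
  rho' (y j) = shift_y iota z (i |: J) j.
Local Notation act a := (lin_op_fun (rho a : lin_op F idx)).
Local Notation act' a := (lin_op_fun (rho' a : lin_op F idx)).

(* In the direction [i], [g] is the geometric progression with ratio [1 / z i] based on [f],
   at least far away from the boundary [alpha i = 0] where [rho] and [rho'] differ. *)
Let tail M (f g : idx -> F) := indep_of (i |: J) f /\
  forall alpha : idx, (M <= alpha i)%N -> g alpha = f alpha * (z i)^-1 ^+ alpha i.

Let act_tail a : exists c, forall M f g, tail M f g -> tail (M + c) (act' a f) (act a g).
Proof.
have indep b f : indep_of (i |: J) f -> indep_of (i |: J) (act' b f).
  exact: (act_indep_of HA rho'_hom rho'xy).
have coord f k alpha : indep_of (i |: J) f -> f (set_coord i k alpha) = f alpha.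
  by apply=> j; rewrite !inE negb_or => /andP[ji _]; apply: set_coord_other.
elim: (presents_Sn_gen HA a) => {a}.
(* Reading at [alpha i] minus one, [x i] needs a margin of one from the boundary; [y i] moves away
   from it and needs none. *)
- move=> j _; exists 1%N => M f g [fJ fg]; split=> [|alpha Ma]; first exact: indep.
  rewrite (act_x rhoxy) (act_x rho'xy) !inE; case: (eqVneq j i) => [->|ji] /=.
    rewrite (negbTE iJ); have a0 : (0 < alpha i)%N by apply: leq_trans Ma; rewrite addn1.
    rewrite -lt0n a0 mul1r fg ?set_coord_at ?coord //.
      by rewrite -[in RHS](prednK a0) exprS mulrACA divff // mul1r.
    by rewrite -ltnS prednK // -addn1.
  have M' : (M <= alpha i)%N by apply: leq_trans Ma; apply: leq_addr.
  case: ifP => _; first by rewrite fg // mulrA.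
  by rewrite fg set_coord_other 1?eq_sym // mulrA.
- move=> j _; exists 0%N => M f g [fJ fg]; rewrite addn0; split=> [|alpha Ma]; first exact: indep.
  rewrite (act_y rhoxy) (act_y rho'xy) !inE; case: (eqVneq j i) => [->|ji] /=.
    rewrite (negbTE iJ) fg ?set_coord_at ?coord //; last exact: leqW.
    by rewrite exprS mulrCA mulrA.
  case: ifP => _; first by rewrite fg // mulrA.
  by rewrite fg set_coord_other 1?eq_sym.
- by exists 0%N => M f g; rewrite addn0 (act1 rho_hom) (act1 rho'_hom).
- move=> a b _ [c Hc] _ [d Hd]; exists (maxn c d) => M f g fg.
  split=> [|alpha Ma]; first by apply: indep; case: fg.
  rewrite (actD rho_hom) (actD rho'_hom) mulrDl.
  rewrite (Hc _ _ _ fg).2 ?(Hd _ _ _ fg).2 //; apply: leq_trans Ma; rewrite leq_add2l.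
    exact: leq_maxr.
  exact: leq_maxl.
- move=> a b _ [c Hc] _ [d Hd]; exists (d + c)%N => M f g /Hd/Hc.
  by rewrite (actM rho_hom) (actM rho'_hom) addnA.
- move=> k a _ [c Hc]; exists c => M f g fg; split=> [|alpha Ma].
    by apply: indep; case: fg.
  by rewrite (actZ rho_hom) (actZ rho'_hom) (Hc _ _ _ fg).2 // mulrA.
Qed.

(** The progression [g] may depend on coordinate [i], so [rho a] kills it. Far from the boundary its
    image is [rho' a] applied to [f], times a nonzero factor; as that function is independent of
    coordinate [i], it vanishes everywhere. *)
Lemma act_kernel_sub a : act_kernel J rho a -> act_kernel (i |: J) rho' a.
Proof.
move=> Ka f fJ alpha; have [c Hc] := act_tail a.
pose g : idx -> F := fun beta => f beta * (z i)^-1 ^+ beta i.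
have gJ : indep_of J g.
  move=> beta gamma bg; rewrite /g (bg i iJ) (fJ beta gamma) // => j.
  by rewrite !inE negb_or => /andP[_]; apply: bg.
have [afJ afE] := Hc 0%N f g (conj fJ (fun _ _ => erefl)).
pose beta := set_coord i (fun=> c) alpha.
rewrite (afJ alpha beta); last first.
  by move=> j; rewrite !inE negb_or => /andP[ji _]; rewrite set_coord_other.
have := afE beta; rewrite add0n set_coord_at leqnn Ka // => /(_ isT)/esym/eqP.
by rewrite mulf_eq0 expf_eq0 invr_eq0 (negbTE (z0 i)) andbF orbF => /eqP.
Qed.
End KernelInclusion.

(** * Primes with prescribed invariants and chains between them *)

Section JacobsonSteps.
Variables (K : fieldType) (n : nat) (A : algType K) (x y : 'I_n -> A).
Hypothesis HA : presents_Sn x y.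
Local Notation R := {mpoly K[n]}.
Implicit Types (P : A -> Prop) (J : {set 'I_n}) (Q : R -> Prop).

(** Only the trace of [Q] on K[x_J] counts, the other variables being set to 1; so one [Q] can be
    used with every support. *)
Definition restrict J Q : R -> Prop := fun p =>
  Q (mmap (@mpolyC n K) (fun i => if i \in J then 'X_i else 1) p).

Definition sn_prime_of J Q P :=
  [/\ is_prime P, idem_support x y P = J & sn_contract HA P = restrict J Q].

Lemma restrict_id J Q : torus_prime J Q -> restrict J Q = Q.
Proof.
move=> [Qp _ QJ]; have [F [phi Qphi]] := prime_point Qp.
apply: same_ideal_eq => p; rewrite /restrict !Qphi.
suff -> : phi (mmap (@mpolyC n K) (fun i => if i \in J then 'X_i else 1) p) = phi p by [].
apply: (mpoly_morph_ext (f := phi \o mmap (@mpolyC n K) _)) => [c|i] /=; first by rewrite mmapC.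
rewrite mmapX mmap1U; case: ifPn => // /QJ/Qphi/eqP.
by rewrite rmorphB subr_eq0 => /eqP.
Qed.

Section Existence.
Variables (Q : R -> Prop) (F : fieldType) (phi : {rmorphism R -> F}).
Hypotheses (Qphi : forall p, Q p <-> phi p = 0) (QX : forall j, ~ Q 'X_j).
Let iota : {rmorphism K -> F} := phi \o @mpolyC n K.
Let z j : F := phi 'X_j.

Let z0 j : z j != 0.
Proof. by apply/eqP => /Qphi; apply: QX. Qed.

Let sn_prime_of_rep J (rho : A -> lin_alg iota ([ffun=> 0%N] : {ffun 'I_n -> nat})) :
  is_alg_hom rho ->
  (forall j, rho (x j) = shift_x iota z J j /\ rho (y j) = shift_y iota z J j) ->
  sn_prime_of J Q (act_kernel J rho).
Proof.
move=> rhm rhE; split.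
- exact: (act_kernel_prime HA rhm rhE).
- exact: (act_kernel_support z0 rhm rhE).
apply: same_ideal_eq => p; rewrite /restrict Qphi.
apply: (act_kernel_contract (z := z) z0 HA rhm rhE
  (phi := phi \o mmap (@mpolyC n K) (fun i => if i \in J then 'X_i else 1))) => [c|j] /=.
  by rewrite mmapC.
by rewrite mmapX mmap1U; case: ifP => // _; rewrite rmorph1.
Qed.

Lemma sn_rep_exists J : exists rho : A -> lin_alg iota ([ffun=> 0%N] : {ffun 'I_n -> nat}),
  is_alg_hom rho /\
  (forall j, rho (x j) = shift_x iota z J j /\ rho (y j) = shift_y iota z J j).
Proof. by have [_ uni] := HA; have [] := uni _ _ _ (shift_rels iota z0 J). Qed.

Lemma sn_point_prime J : exists P, sn_prime_of J Q P.
Proof. by have [rho [rh rE]] := sn_rep_exists J; exists (act_kernel J rho); apply: sn_prime_of_rep. Qed.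

Lemma sn_point_prime_pair J i : i \notin J -> exists P P',
  [/\ sn_prime_of J Q P, sn_prime_of (i |: J) Q P' & forall a, P a -> P' a].
Proof.
move=> iJ; have [rho [rh rE]] := sn_rep_exists J; have [rho' [rh' rE']] := sn_rep_exists (i |: J).
exists (act_kernel J rho), (act_kernel (i |: J) rho'); split; try exact: sn_prime_of_rep.
exact: (act_kernel_sub z0 iJ HA rh rh' rE rE').
Qed.
End Existence.

Lemma sn_prime_exists J Q : comm_prime Q -> (forall j, ~ Q 'X_j) ->
  exists P, sn_prime_of J Q P.
Proof. by move=> /prime_point[F [phi Qphi]] QX; apply: sn_point_prime Qphi QX _. Qed.

Lemma sn_prime_of_inj J Q Q' P P' : sn_prime_of J Q P -> sn_prime_of J Q' P' ->
  restrict J Q = restrict J Q' -> P = P'.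
Proof.
move=> [Pp PJ PQ] [P'p P'J P'Q] E; apply: (@sn_prime_eq _ _ _ _ _ HA _ _ Pp P'p).
  by rewrite PJ P'J.
by rewrite PQ P'Q.
Qed.

(** Both primes are determined by their invariants, hence they are the two kernels at one point
    compared in [act_kernel_sub]; the idempotent of [i] separates them. *)
Lemma sn_prime_of_strict J Q i P P' : comm_prime Q -> (forall j, ~ Q 'X_j) -> i \notin J ->
  sn_prime_of J Q P -> sn_prime_of (i |: J) Q P' -> strict_sub P P'.
Proof.
move=> Qp QX iJ PQ P'Q; have [F [phi Qphi]] := prime_point Qp.
have [P1 [P1' [P1Q P1'Q sub]]] := sn_point_prime_pair Qphi QX iJ.
rewrite (sn_prime_of_inj PQ P1Q) // (sn_prime_of_inj P'Q P1'Q) //.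
have [_ P1J _] := P1Q; have [_ P1'J _] := P1'Q; split=> //.
exists (sn_idem x y i); split; apply/idem_supportP; first by rewrite P1'J setU11.
by rewrite P1J.
Qed.

Lemma sn_steps_lift J m Q Q' P : steps (torus_prime J) m Q Q' ->
  (sn_prime_of J Q P -> exists P', steps (@is_prime A) m P P' /\ sn_prime_of J Q' P') /\
  (sn_prime_of J Q' P -> exists P', steps (@is_prime A) m P' P /\ sn_prime_of J Q P').
Proof.
move=> QQ'; have [tQ tQ'] := steps_ends QQ'.
pose G' P := is_prime P /\ idem_support x y P = J.
have onto a : torus_prime J a -> exists2 P, G' P & sn_contract HA P = a.
  move=> ta; have [ap aX _] := ta; have [P1 [P1p P1J P1Q]] := sn_prime_exists J ap aX.
  by exists P1; rewrite // P1Q restrict_id.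
have refl a b : G' a -> G' b -> strict_sub (sn_contract HA a) (sn_contract HA b) -> strict_sub a b.
  move=> [ap aJ] [bp bJ] [sub [p [bQ aQ]]]; split.
    by apply: (@sn_prime_le _ _ _ _ _ HA _ _ ap bp) => //; rewrite aJ bJ.
  rewrite /sn_contract aJ in aQ; rewrite /sn_contract bJ in bQ.
  by exists (sn_eval HA J p).
have [P1 [P2 [s P1Q P2Q]]] := steps_lift onto refl QQ'.
have [[P1p P1J] [P2p P2J]] := steps_ends s.
have P1of : sn_prime_of J Q P1 by split=> //; rewrite restrict_id.
have P2of : sn_prime_of J Q' P2 by split=> //; rewrite restrict_id.
have s' : steps (@is_prime A) m P1 P2.
  by move: s; apply: (steps_map (f := id)) => // a [].
split=> Pof.
  by exists P2; rewrite (sn_prime_of_inj Pof P1of).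
by exists P1; rewrite (sn_prime_of_inj Pof P2of).
Qed.

(** [Q] stays fixed while the indices leave the support one at a time. *)
Lemma sn_steps_below J Q P : comm_prime Q -> (forall j, ~ Q 'X_j) -> sn_prime_of J Q P ->
  exists P', steps (@is_prime A) #|J| P' P.
Proof.
move=> Qp QX; move: {2}#|J| (erefl #|J|) => m; elim: m J P => [|m IH] J P Jm PQ.
  by rewrite Jm; exists P; apply: steps0; case: PQ.
have /card_gt0P[i iJ] : (0 < #|J|)%N by rewrite Jm.
have [P1 P1Q] := sn_prime_exists (J :\ i) Qp QX.
have Jm' : #|J :\ i| = m by have := cardsD1 i J; rewrite Jm iJ add1n => -[].
have [P0 s] := IH _ _ Jm' P1Q; exists P0; rewrite Jm -Jm'.
have PQ' : sn_prime_of (i |: J :\ i) Q P by rewrite setD1K.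
apply: steps_rcons s _ _; last by case: PQ.
by apply: sn_prime_of_strict P1Q PQ' => //; rewrite !inE eqxx.
Qed.

(** A prime with support [J] thus belongs to [Q] and to [poly_ext i Q] alike, which permits [i] to
    enter the support with [x_i] still an indeterminate. *)
Lemma restrict_poly_ext J i Q : is_ideal Q -> i \notin J ->
  restrict J (poly_ext i Q) = restrict J Q.
Proof.
move=> Qi iJ; apply: same_ideal_eq => p; rewrite /restrict.
set psi := mmap _ _; have <- : proj_vars J (psi p) = psi p.
  apply: (mpoly_morph_ext (f := proj_vars J \o psi)) => [c|k] /=.
    by rewrite /psi mmapC proj_varsC.
  by rewrite /psi mmapX mmap1U; case: ifP => kJ; rewrite ?rmorph1 // proj_varsX kJ.
exact: poly_ext_const.
Qed.

(* Each [i] outside [J] contributes two steps: first [e_i] enters with [x_i] an indeterminate, then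
   [x_i - 1] enters. *)
Lemma sn_steps_above J Q P : torus_prime J Q -> sn_prime_of J Q P ->
  exists P', steps (@is_prime A) (2 * #|~: J|) P P'.
Proof.
move: {2}#|~: J| (erefl #|~: J|) => m; elim: m J P => [|m IH] J P Jm tQ PQ.
  by rewrite Jm; exists P; apply: steps0; case: PQ.
have /card_gt0P[i] : (0 < #|~: J|)%N by rewrite Jm.
rewrite inE => iJ; have [Qp QX QJ] := tQ; have [Qi Q1 _] := Qp.
have tQ' : torus_prime (i |: J) Q.
  by split=> // k; rewrite !inE negb_or => /andP[_]; apply: QJ.
have tE := torus_poly_ext i tQ; have [Ep EX _] := tE.
have [P1 P1Q] := sn_prime_exists (i |: J) Ep EX.
have [P2 P2Q] := sn_prime_exists (i |: J) Qp QX.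
have PE : sn_prime_of J (poly_ext i Q) P by case: PQ => ? ? PC; split; rewrite ?restrict_poly_ext.
have Jm' : #|~: (i |: J)| = m.
  have := card_setC_sub (subsetUr [set i] J).
  by rewrite Jm setDUl setDv setU0 (setDidPl _) ?disjoints1 // cards1 addn1 => -[].
have [P' s] := IH _ _ Jm' tQ' P2Q; exists P'; rewrite Jm -Jm' mulnS !addSn add0n.
have PP1 := sn_prime_of_strict Ep EX iJ PE P1Q.
have [Pp _ _] := PQ; have [P1p P1J P1E] := P1Q; have [P2p P2J P2E] := P2Q.
apply: (stepsS Pp PP1); apply: (stepsS P1p _ s); split.
  apply: (@sn_prime_le _ _ _ _ _ HA _ _ P1p P2p); first by rewrite P1J P2J.
  by rewrite P1E P2E !restrict_id // => p; apply: poly_ext_sub.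
exists (sn_eval HA (i |: J) ('X_i - 1)); split.
  have : sn_contract HA P2 ('X_i - 1) by rewrite P2E restrict_id //; apply: QJ.
  by rewrite /sn_contract P2J.
move=> P1X; have : sn_contract HA P1 ('X_i - 1) by rewrite /sn_contract P1J.
by rewrite P1E restrict_id // -mpolyC1; apply: poly_ext_var.
Qed.
End JacobsonSteps.

(** * Invariants of the given prime *)

Section TensorIdeal.
Variables (K : fieldType) (n : nat) (A : algType K) (x y : 'I_n -> A).
Hypothesis HA : presents_Sn x y.
Variables (N : {set 'I_n}) (L : comAlgType K) (t u : 'I_n -> L).
Local Notation S := (~: N).
Hypothesis HL : presents_Laurent S t u.
Variables (pi : A -> L) (q : L -> Prop).
Hypotheses (Hpi : is_pi x y S t u pi) (Hq : is_prime q).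
Local Notation p := (tensor_ideal x y N (pi_preimage x y S pi q)).

Lemma tensor_ideal_preimage r : subalg x y S r -> q (pi r) -> p r.
Proof.
move=> Sr qr; exists [:: (1, r)]; split; last by rewrite big_seq1 mul1r.
by move=> z; rewrite inE => /eqP->; split=> //; apply: subalg_1.
Qed.

Lemma pi_sn_eval f :
  subalg x y S (sn_eval HA S f) /\ pi (sn_eval HA S f) = laurent_eval S t f.
Proof.
have [piD piM pi1 piZ piE] := Hpi; elim/mpoly_gen_ind: f => [c|i|f g [Sf Ef] [Sg Eg]|f g [Sf Ef] [Sg Eg]].
- rewrite sn_evalC laurent_evalC; split; first exact/subalg_scale/subalg_1.
  by rewrite piZ ?pi1 //; apply: subalg_1.
- rewrite sn_evalX laurent_evalX; case: ifP => iS; last by split=> //; apply: subalg_1.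
  by split; [apply: subalg_x|case: (piE i iS)].
- by rewrite !rmorphD /= piD // Ef Eg; split=> //; apply: subalg_add.
- by rewrite !rmorphM /= piM // Ef Eg; split=> //; apply: subalg_mul.
Qed.

(** That [p] contains the expected idempotents and polynomials is direct. That it contains no others
    follows from the inclusion in the prime [P] constructed with these invariants, proved on the
    generators by clearing denominators. *)
Lemma tensor_prime_of : is_prime p -> sn_prime_of HA S (contract S t q) p.
Proof.
move=> pp; have tQ := contract_torus HL Hq; have [Qp QX _] := tQ.
have [tu _] := HL; have [[q0 _ qM _] _ _] := Hq; have [piD piM pi1 piZ piE] := Hpi.
have [P PQ] := sn_prime_exists HA S Qp QX; have [Pp PJ PC] := PQ.
have [[P0 PD PM PM'] _ _] := Pp; rewrite restrict_id // in PC.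
have pP a : p a -> P a.
  move=> [s [Hs ->]]; rewrite big_seq; apply: (big_ind P) => // -[b r] /Hs[/= _ [Sr qr]].
  apply: (PM); have [m [f [mod_f pi_f]]] := sn_clear HA Sr.
  have Qf : contract S t q f by rewrite /contract -(pi_f _ _ _ _ tu Hpi); apply: qM.
  have [v vX] := sn_monomial_inv HA S m; rewrite -[r]mul1r -vX -mulrA; apply: PM.
  rewrite -(subrK (sn_eval HA S f) (_ * r)); apply: (PD).
    by apply: mod_f => [|j]; [case: Pp|rewrite -PJ => /idem_supportP].
  by move: Qf; rewrite -PC /sn_contract PJ.
have pJ : idem_support x y p = S.
  apply/setP => i; apply/idem_supportP/idP => [/pP/idem_supportP|iS]; first by rewrite PJ.
  have Sx : subalg x y S (x i) by apply: subalg_x.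
  have Sy : subalg x y S (y i) by apply: subalg_y.
  have Sxy := subalg_mul Sx Sy; have S1 := subalg_1 x y S.
  rewrite /sn_idem -scaleN1r; apply: tensor_ideal_preimage.
    by apply: subalg_add => //; apply: subalg_scale.
  rewrite piD ?piZ ?piM //; last exact: subalg_scale.
  by case: (piE i iS) => -> ->; rewrite tu // pi1 scaleN1r subrr.
split=> //; rewrite restrict_id //; apply: same_ideal_eq => f; rewrite /sn_contract pJ.
split=> [/pP|Qf]; first by rewrite -PC /sn_contract PJ.
have [Sf Ef] := pi_sn_eval f; apply: tensor_ideal_preimage => //.
by rewrite Ef.
Qed.
End TensorIdeal.

Theorem theorem4p12 (K : fieldType) (n : nat) (A : algType K) (x y : 'I_n -> A)
  (HA : presents_Sn x y)
  (N : {set 'I_n}) (L : comAlgType K) (t u : 'I_n -> L)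
  (HL : presents_Laurent (~: N) t u)
  (pi : A -> L) (Hpi : is_pi x y (~: N) t u pi)
  (q : L -> Prop) (Hq : is_prime q)
  (Hp : is_prime (tensor_ideal x y N (pi_preimage x y (~: N) pi q))) :
  let p := tensor_ideal x y N (pi_preimage x y (~: N) pi q) in
  (exists m, height_is q m /\ height_is p (#|~: N| + m)%N) /\
  (exists m, coheight_is q m /\ coheight_is p (2 * #|N| + m)%N) /\
  (exists h c, [/\ height_is p h, coheight_is p c, (h + c = 2 * n)%N
                 & kdim_is A (2 * n)]).
Proof.
move=> p; set S := ~: N in HL Hpi p Hp *; set Q := contract S t q.
have tQ : torus_prime S Q := contract_torus HL Hq; have [Qp QX _] := tQ.
have [Qi Q1 _] := Qp.
have pQ : sn_prime_of HA S Q p := tensor_prime_of HA HL Hpi Hq Hp.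
have [J _ Jmax] := indep_extend (indep0 Qi Q1).
have [hq cq] := laurent_height HL Hq Jmax.
(* Both halves first move with support [S] fixed, down to [Q0] and up to [Q1'], and only then change
   the support. Shrinking it directly at [Q] could skip primes in which an algebraic [x_i] has
   become an indeterminate. *)
have [Q0 sQ0] := torus_steps_below tQ Jmax.
have [Q1' sQ1] := torus_steps_above tQ Jmax (leqnn _).
have [_ /(_ pQ)[P0 [sP0 P0Q]]] := sn_steps_lift HA p sQ0.
have [/(_ pQ)[P1 [sP1 P1Q]] _] := sn_steps_lift HA p sQ1.
have [[Q0p Q0X _] _] := steps_ends sQ0; have [_ tQ1] := steps_ends sQ1.
have [P00 sP00] := sn_steps_below Q0p Q0X P0Q.
have [P11 sP11] := sn_steps_above tQ1 P1Q.
(* As [J] lies in [S], the terms [#|S :\: J|] and [#|J|] add up to a second [#|S|]. *)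
have sum : ((#|S| + #|S :\: J|) + (#|J| + 2 * #|~: S|) = 2 * n)%N.
  rewrite addnACA -[X in (_ = 2 * X)%N]card_ord -(cardsC S) mulnDr [in RHS]mulSn mul1n.
  have := cardsID J S; rewrite (setIidPr _); last exact: torus_indep_sub tQ Jmax.1.
  by lia.
have [hp cp kp] := height_coheight (@sn_rank_lt _ _ _ _ _ HA) (@sn_rank_le _ _ _ _ _ HA)
  (steps_trans sP00 sP0) (steps_trans sP1 sP11) sum.
rewrite setCK in cp sum *; split; first by exists #|S :\: J|.
split; first by exists #|J|; rewrite addnC.
by exists (#|S| + #|S :\: J|)%N, (#|J| + 2 * #|N|)%N.
Qed.
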